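(* Let $P_n$ and $C_n$ denote the path and the cycle on $n$ vertices. (1) Two elements $x,y\in A(P_2)=\mathbb{Z}^2$ form a vertex basis if and only if $x$ and $y\langle x\rangle\in A(P_2)/\langle x\rangle$ are not multiples of other elements. (2) Elements $\xi,\eta,\zeta$ form a vertex basis of $A(C_3)=\mathbb{Z}^3$ if and only if $A(C_3)/\langle\zeta\rangle\cong\mathbb{Z}^2$ and $\xi\langle\zeta\rangle,\eta\langle\zeta\rangle\in A(C_3)/\langle\zeta\rangle$ satisfy the conditions imposed on $x$ and $y$ in (1), i.e. $\xi\langle\zeta\rangle$ is not a multiple of another element of $A(C_3)/\langle\zeta\rangle$ and the image of $\eta$ in $A(C_3)/\langle\zeta,\xi\rangle$ is not a multiple of another element. (3) Elements $\chi,a,b$ form a vertex basis of $A(P_3)=\mathbb{Z}\oplus F_2$, with $\chi$ corresponding to the inner vertex and $a$ and $b$ to the endpoints, if and only if the centralizer $C(\chi)$ is non-abelian, $\chi$ generates the center of $C(\chi)$, and $C(\chi)=\langle\chi,a,b\rangle$. (4) Let $u_1,u_2,u_3,u_4$ be elements in the RAAG $A(C_4)=F_2\oplus F_2$. Then they form a vertex basis (with $u_i$ and $u_{i+1}$ arising from adjacent vertices, indices modulo $4$) if and only if for any index $i$ modulo $4$ the centralizer $C(u_i)$ is non-abelian, $C(u_i)=\langle u_{i-1},u_i,u_{i+1}\rangle$ and $A(C_4)/\langle\langle u_i\rangle\rangle$ is a RAAG with the property that $d(A(C_4))=d(A(C_4)/\langle\langle u_i\rangle\rangle)+1$.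
   Context: All graphs are finite, undirected and simple. The right-angled Artin group (RAAG) with underlying graph $\Gamma$ is $A(\Gamma)=\langle v\in V(\Gamma)\mid [v,w]=1\text{ whenever }\{v,w\}\in E(\Gamma)\rangle$. A vertex basis of $A(\Gamma)$ is a generating set as in this presentation, i.e. the image $\varphi(V(\Gamma))$ of the standard generators under an automorphism $\varphi$ of $A(\Gamma)$; $\varphi(v)$ is said to arise from (correspond to) the vertex $v$. An element $g$ of an (additively written) abelian group is a multiple of another element if $g=ku$ for some element $u$ and integer $k$ with $|k|\ge 2$. $F_2$ is the free group of rank $2$, $\oplus$ the direct product, $\langle\langle u\rangle\rangle$ the normal closure of $u$, and $d(G)$ the minimal number of generators of a finitely generated group $G$. *)

(* Defs.v *)
From HB Require Import structures.
From mathcomp Require Import all_boot all_algebra.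
From mathcomp Require Import boolp classical_sets.

Set Implicit Arguments.
Unset Strict Implicit.
Unset Printing Implicit Defensive.

Local Open Scope quotient_scope.
Local Open Scope classical_set_scope.
Local Open Scope group_scope.

Section Subgroups.
Context {G : groupType}.
Implicit Types (H S : set G) (x y z : G).

Definition is_subgroup H : Prop := group_closed [in H].

Definition is_normal_subgroup H : Prop :=
  is_subgroup H /\ forall x y, H x -> H (x ^ y).

Definition gen S : set G := smallest is_subgroup S.

Definition normal_closure S : set G := smallest is_normal_subgroup S.

Definition centralizer x : set G := [set y | commute x y].

Definition center H : set G :=
  [set z | H z /\ forall y, H y -> commute z y].

Definition abelian_set H : Prop := forall x y, H x -> H y -> commute x y.

Definition zpowg x (k : int) : G :=
  match k with Posz n => x ^+ n | Negz n => x ^- n.+1 end.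

(* In additive notation: [g = k u] with [|k| >= 2].  In particular the neutral
   element is a multiple. *)
Definition is_multiple x : Prop :=
  exists (u : G) (k : int), (2 <= `|k|)%N /\ x = zpowg u k.

Lemma is_subgroupP H :
  is_subgroup H <-> H 1 /\ forall x y, H x -> H y -> H (x / y).
Proof.
split=> [[]|[H1 HF]].
  rewrite in_setE => H1 HF; split=> // x y Hx Hy.
  by move: (HF x y); rewrite !in_setE; exact.
by split=> [|x y]; rewrite !in_setE //; exact: HF.
Qed.

Lemma gen_subgroup S : is_subgroup (gen S).
Proof.
apply/is_subgroupP; split=> [H [/is_subgroupP[]]//|x y Sx Sy H HS].
by have [/is_subgroupP[_ HF] _] := HS; exact: HF (Sx _ HS) (Sy _ HS).
Qed.

Lemma sub_gen S : S `<=` gen S.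
Proof. exact: sub_smallest. Qed.

Lemma normal_closure_normal S : is_normal_subgroup (normal_closure S).
Proof.
split=> [|x y Sx H HS]; last by have [[_ +] _] := HS; apply; exact: Sx HS.
apply/is_subgroupP; split=> [H [[/is_subgroupP[]]]//|x y Sx Sy H HS].
by have [[/is_subgroupP[_ HF] _] _] := HS; exact: HF (Sx _ HS) (Sy _ HS).
Qed.

Lemma gen_normal S :
  (forall x y, commute x y) -> is_normal_subgroup (gen S).
Proof.
move=> cG; split=> [|x y Sx]; first exact: gen_subgroup.
by rewrite conjgE (cG x y) mulKg.
Qed.

End Subgroups.

(* The least size of a generating sequence; the default value 0 is only taken
   by groups that are not finitely generated. *)
Definition gen_by_number (G : groupType) (n : nat) : Prop :=
  exists s : seq G, size s = n /\ gen [set` s] = setT.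

Definition min_gens (G : groupType) : nat :=
  if pselect (exists n, `[< gen_by_number G n >]) is left ex_n
  then ex_minn ex_n else 0.

Definition isomorphic (G H : groupType) : Prop :=
  exists f : {multiplicative G -> H}, bijective f.

Definition isomorphic_add (G : groupType) (V : zmodType) : Prop :=
  exists f : G -> V, bijective f /\ {morph f : x y / x * y >-> (x + y)%R}.

Record normal_subgroup (G : groupType) := NormalSubgroup {
  nset :> set G;
  nsetP : is_normal_subgroup nset }.

Definition nclosure (G : groupType) (S : set G) : normal_subgroup G :=
  NormalSubgroup (normal_closure_normal S).

Definition abelian_gen (G : groupType) (cG : forall x y : G, commute x y)
    (S : set G) : normal_subgroup G :=
  NormalSubgroup (gen_normal S cG).

Section Quotient.
Context {G : groupType}.
Variable N : normal_subgroup G.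
Implicit Types x y z : G.

Let N1 : nset N 1.
Proof. by have [/is_subgroupP[]] := nsetP N. Qed.

Let NF x y : nset N x -> nset N y -> nset N (x / y).
Proof. by have [/is_subgroupP[_ +] _] := nsetP N; apply. Qed.

Let NV x : nset N x -> nset N x^-1.
Proof. by move=> Nx; rewrite -div1g; exact: NF. Qed.

Let NM x y : nset N x -> nset N y -> nset N (x * y).
Proof. by move=> Nx Ny; rewrite -[y]invgK; apply/NF/NV. Qed.

Let NJ x y : nset N x -> nset N (x ^ y).
Proof. by have [_] := nsetP N; apply. Qed.

Definition coset_eq x y : bool := `[< nset N (x^-1 * y) >].

Lemma coset_eq_equiv : equiv_class_of coset_eq.
Proof.
split=> [x|x y|y x z].
- by apply/asboolP; rewrite mulVg.
- by apply/asboolP/asboolP => /NV; rewrite invgM invgK.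
- move=> /asboolP Nxy /asboolP Nyz; apply/asboolP.
  by rewrite -(mulVKg y z) mulgA; exact: NM.
Qed.

Canonical coset_eq_equiv_rel := EquivRelPack coset_eq_equiv.

Definition quot := {eq_quot coset_eq}.

HB.instance Definition _ := Choice.on quot.
HB.instance Definition _ := EqQuotient.on quot.

Definition coset x : quot := \pi x.

Lemma cosetP x y : coset x = coset y <-> nset N (x^-1 * y).
Proof.
split=> [/eqP|Nxy]; first by rewrite eqmodE => /asboolP.
by apply/eqP; rewrite eqmodE; apply/asboolP.
Qed.

Lemma coset_surj (a : quot) : exists x, a = coset x.
Proof. by exists (repr a); rewrite /coset reprK. Qed.

Definition quot_mul (a b : quot) : quot := coset (repr a * repr b).
Definition quot_one : quot := coset 1.
Definition quot_inv (a : quot) : quot := coset (repr a)^-1.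

Let N_repr x : nset N ((repr (coset x))^-1 * x).
Proof. by apply/cosetP; rewrite /coset reprK. Qed.

Lemma coset_mul x y : quot_mul (coset x) (coset y) = coset (x * y).
Proof.
apply/cosetP; set x' := repr _; set y' := repr _.
have -> : (x' * y')^-1 * (x * y) = (x'^-1 * x) ^ y' * (y'^-1 * y).
  by rewrite conjgE invgM !mulgA mulgK.
by apply: NM (N_repr y); exact/NJ/N_repr.
Qed.

Lemma coset_inv x : quot_inv (coset x) = coset x^-1.
Proof.
apply/cosetP; rewrite invgK; set x' := repr _.
have -> : x' * x^-1 = ((x'^-1 * x)^-1) ^ x'^-1.
  by rewrite conjgE invgM !invgK !mulgA mulgK.
by apply/NJ/NV/N_repr.
Qed.

Let quot_mulA : associative quot_mul.
Proof.
move=> a b c; have [x ->] := coset_surj a; have [y ->] := coset_surj b.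
by have [z ->] := coset_surj c; rewrite !coset_mul mulgA.
Qed.

Let quot_mul1 : left_id quot_one quot_mul.
Proof. by move=> a; have [x ->] := coset_surj a; rewrite coset_mul mul1g. Qed.

Let quot_1mul : right_id quot_one quot_mul.
Proof. by move=> a; have [x ->] := coset_surj a; rewrite coset_mul mulg1. Qed.

Let quot_mulV : left_inverse quot_one quot_inv quot_mul.
Proof.
move=> a; have [x ->] := coset_surj a.
by rewrite coset_inv coset_mul mulVg.
Qed.

Let quot_mulrV : right_inverse quot_one quot_inv quot_mul.
Proof.
move=> a; have [x ->] := coset_surj a.
by rewrite coset_inv coset_mul mulgV.
Qed.

HB.instance Definition _ :=
  isGroup.Build quot quot_mulA quot_mul1 quot_1mul quot_mulV quot_mulrV.

Lemma cosetM : {morph coset : x y / x * y}.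
Proof. by move=> x y; rewrite -coset_mul. Qed.

Lemma coset_monoid_morphism : monoid_morphism coset.
Proof. by split; [|exact: cosetM]. Qed.

HB.instance Definition _ :=
  isUMagmaMorphism.Build G quot coset coset_monoid_morphism.

End Quotient.

(* A letter [(x, false)] stands for [x], and [(x, true)] for its inverse. *)
Notation word X := (seq (X * bool)).

Definition inv_word (X : Type) (w : word X) : word X :=
  rev [seq (l.1, ~~ l.2) | l <- w].

Inductive free_eq (X : Type) : word X -> word X -> Prop :=
| FreeCancel u v x b : free_eq (u ++ (x, b) :: (x, ~~ b) :: v) (u ++ v)
| FreeRefl u : free_eq u u
| FreeSym u v : free_eq u v -> free_eq v u
| FreeTrans v u w : free_eq u v -> free_eq v w -> free_eq u w.

Section FreeGroup.
Variable X : choiceType.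
Implicit Types u v w : word X.

Definition free_eqb u v : bool := `[< free_eq u v >].

Lemma free_eqb_equiv : equiv_class_of free_eqb.
Proof.
split=> [u|u v|v u w].
- exact/asboolP/FreeRefl.
- by apply/asboolP/asboolP => /FreeSym.
- by move=> /asboolP uv /asboolP vw; apply/asboolP/(FreeTrans uv vw).
Qed.

Canonical free_eqb_equiv_rel := EquivRelPack free_eqb_equiv.

Definition free := {eq_quot free_eqb}.

HB.instance Definition _ := Choice.on free.
HB.instance Definition _ := EqQuotient.on free.

Definition of_word u : free := \pi u.

Lemma of_wordP u v : of_word u = of_word v <-> free_eq u v.
Proof.
split=> [/eqP|uv]; first by rewrite eqmodE => /asboolP.
by apply/eqP; rewrite eqmodE; apply/asboolP.
Qed.

Lemma of_word_surj (a : free) : exists u, a = of_word u.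
Proof. by exists (repr a); rewrite /of_word reprK. Qed.

Definition free_mul (a b : free) : free := of_word (repr a ++ repr b).
Definition free_one : free := of_word [::].
Definition free_inv (a : free) : free := of_word (inv_word (repr a)).

Lemma free_eq_cat u u' v v' :
  free_eq u u' -> free_eq v v' -> free_eq (u ++ v) (u' ++ v').
Proof.
move=> uu' vv'; apply: (@FreeTrans _ (u' ++ v)).
  elim: uu' => {u u'} [u w x b|u|u w _|w u t _ IH1 _ IH2].
  - by rewrite -!catA !cat_cons; exact: FreeCancel.
  - exact: FreeRefl.
  - exact: FreeSym.
  - exact: FreeTrans IH1 IH2.
elim: vv' => {v v'} [v w x b|v|v w _|w v t _ IH1 _ IH2].
- by rewrite !catA; exact: FreeCancel.
- exact: FreeRefl.
- exact: FreeSym.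
- exact: FreeTrans IH1 IH2.
Qed.

Lemma free_eq_inv u v : free_eq u v -> free_eq (inv_word u) (inv_word v).
Proof.
elim=> {u v} [u v x b|u|u v _|v u w _ IH1 _ IH2].
- rewrite /inv_word !map_cat !rev_cat /= !rev_cons -!cats1 -!catA /=.
  rewrite negbK; exact: FreeCancel.
- exact: FreeRefl.
- exact: FreeSym.
- exact: FreeTrans IH1 IH2.
Qed.

Lemma inv_wordK u : inv_word (inv_word u) = u.
Proof.
rewrite /inv_word map_rev revK -map_comp -[RHS]map_id.
by apply: eq_map => -[x b] /=; rewrite negbK.
Qed.

Lemma free_eq_mulV u : free_eq (u ++ inv_word u) [::].
Proof.
elim: u => [|[x b] u IH]; first exact: FreeRefl.
rewrite /inv_word /= rev_cons -cats1 -/(inv_word u).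
apply: FreeTrans (FreeCancel [::] [::] x b).
apply: (@free_eq_cat [:: (x, b)] [:: (x, b)]); first exact: FreeRefl.
by rewrite catA; apply: (free_eq_cat IH); exact: FreeRefl.
Qed.

Let free_eq_repr u : free_eq (repr (of_word u)) u.
Proof. by apply/of_wordP; rewrite /of_word reprK. Qed.

Lemma of_word_mul u v : free_mul (of_word u) (of_word v) = of_word (u ++ v).
Proof. by apply/of_wordP/free_eq_cat. Qed.

Lemma of_word_inv u : free_inv (of_word u) = of_word (inv_word u).
Proof. exact/of_wordP/free_eq_inv. Qed.

Let free_mulA : associative free_mul.
Proof.
move=> a b c; have [x ->] := of_word_surj a; have [y ->] := of_word_surj b.
by have [z ->] := of_word_surj c; rewrite !of_word_mul catA.
Qed.

Let free_1mul : left_id free_one free_mul.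
Proof. by move=> a; have [x ->] := of_word_surj a; rewrite of_word_mul. Qed.

Let free_mul1 : right_id free_one free_mul.
Proof.
by move=> a; have [x ->] := of_word_surj a; rewrite of_word_mul cats0.
Qed.

Let free_mulrV : right_inverse free_one free_inv free_mul.
Proof.
move=> a; have [u ->] := of_word_surj a.
by rewrite of_word_inv of_word_mul; exact/of_wordP/free_eq_mulV.
Qed.

Let free_mulV : left_inverse free_one free_inv free_mul.
Proof.
move=> a; have [u ->] := of_word_surj a.
rewrite of_word_inv of_word_mul -{2}(inv_wordK u).
exact/of_wordP/free_eq_mulV.
Qed.

HB.instance Definition _ :=
  isGroup.Build free free_mulA free_1mul free_mul1 free_mulV free_mulrV.

Definition free_gen (x : X) : free := of_word [:: (x, false)].

Lemma of_wordM u v : of_word (u ++ v) = of_word u * of_word v.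
Proof. by rewrite -of_word_mul. Qed.

Lemma of_wordV x : of_word [:: (x, true)] = (free_gen x)^-1.
Proof. by rewrite /free_gen -[RHS]/(free_inv _) of_word_inv. Qed.

Lemma gen_free : gen (range free_gen) = setT.
Proof.
rewrite -subTset => a _; have [u ->] := of_word_surj a => H HS.
have [/is_subgroupP[H1 HF] genH] := HS.
have Hg x : H (free_gen x) by apply: genH; exists x.
have HV y : H y -> H y^-1 by move=> Hy; rewrite -div1g; exact: HF.
elim: u => [|[x b] u IH]; first exact: H1.
rewrite -cat1s of_wordM -[of_word u]invgK; apply: HF; last exact: HV.
by case: b; [rewrite of_wordV; exact: HV|exact: Hg].
Qed.

End FreeGroup.

Record sgraph := SGraph {
  vertex :> finType;
  adj : rel vertex;
  adj_sym : symmetric adj;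
  adj_irrefl : irreflexive adj }.

Definition raag_relators (Gamma : sgraph) : set (free Gamma) :=
  [set r | exists v w : Gamma,
     adj v w /\ r = [~ free_gen v, free_gen w]].
Arguments raag_relators : clear implicits.

Definition raag (Gamma : sgraph) : groupType :=
  quot (nclosure (raag_relators Gamma)).

Definition raag_gen (Gamma : sgraph) (v : Gamma) : raag Gamma :=
  coset (nclosure (raag_relators Gamma)) (free_gen v).

Definition is_raag (G : groupType) : Prop :=
  exists Gamma : sgraph, isomorphic G (raag Gamma).

Definition vertex_basis_by (Gamma : sgraph)
    (phi : {multiplicative raag Gamma -> raag Gamma}) (S : set (raag Gamma)) :
    Prop :=
  bijective phi /\ S = phi @` range (@raag_gen Gamma).

Definition vertex_basis (Gamma : sgraph) (S : set (raag Gamma)) : Prop :=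
  exists phi : {multiplicative raag Gamma -> raag Gamma},
    vertex_basis_by phi S.

Lemma raag_commute (Gamma : sgraph) :
  (forall v w : Gamma, v != w -> adj v w) ->
  forall x y : raag Gamma, commute x y.
Proof.
move=> complete; pose pi := coset (nclosure (raag_relators Gamma)).
have cgen v w : commute (pi (free_gen v)) (pi (free_gen w)).
  have [->|vw] := eqVneq v w; first exact: commute_refl.
  apply: esym; rewrite /pi -!cosetM; apply/cosetP; rewrite invgM -mulgA.
  have -> : (free_gen v)^-1 * ((free_gen w)^-1 * (free_gen v * free_gen w)) =
            [~ free_gen v, free_gen w] by rewrite commgEl conjgE.
  by move=> H [_]; apply; exists v, w; rewrite complete.
have csub a : is_subgroup [set x | commute (pi x) a].
  apply/is_subgroupP; split=> [|x y xa ya] /=.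
    by rewrite /pi gmulf1; exact/commute_sym/commute1.
  rewrite /pi gmulfF; apply/commute_sym/commuteM; first exact: commute_sym.
  exact/commuteV/commute_sym.
have cgenl a : (forall v, commute (pi (free_gen v)) a) ->
    forall x, commute (pi x) a.
  move=> ca x; have gx : gen (range (@free_gen Gamma)) x by rewrite gen_free.
  apply: (gx [set x | commute (pi x) a]).
  by split=> [|_ [v _ <-]]; [exact: csub|exact: ca].
move=> a b; have [x ->] := coset_surj a; have [y ->] := coset_surj b.
apply: (cgenl) => v; apply/commute_sym.
by apply: cgenl => w; exact: cgen.
Qed.

Section PathCycle.
Variable n : nat.
Implicit Types i j : 'I_n.

Definition path_adj : rel 'I_n :=
  fun i j => (val j == (val i).+1) || (val i == (val j).+1).

Lemma path_adj_sym : symmetric path_adj.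
Proof. by move=> i j; rewrite /path_adj orbC. Qed.

Lemma path_adj_irrefl : irreflexive path_adj.
Proof. by move=> i; rewrite /path_adj orbb ltn_eqF. Qed.

Definition path_graph := SGraph path_adj_sym path_adj_irrefl.

(* [ordS] is the successor modulo [n]; this is the usual cycle for [n >= 3]. *)
Definition cycle_adj : rel 'I_n :=
  fun i j => (i != j) && ((j == ordS i) || (i == ordS j)).

Lemma cycle_adj_sym : symmetric cycle_adj.
Proof. by move=> i j; rewrite /cycle_adj eq_sym orbC. Qed.

Lemma cycle_adj_irrefl : irreflexive cycle_adj.
Proof. by move=> i; rewrite /cycle_adj eqxx. Qed.

Definition cycle_graph := SGraph cycle_adj_sym cycle_adj_irrefl.

End PathCycle.

Lemma raag_P2_commute (x y : raag (path_graph 2)) : commute x y.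
Proof. by apply: raag_commute => -[[|[|//]] ?] [[|[|//]] ?]. Qed.

Lemma raag_C3_commute (x y : raag (cycle_graph 3)) : commute x y.
Proof. by apply: raag_commute => -[[|[|[|//]]] ?] [[|[|[|//]]] ?]. Qed.

(* Main.v *)
(* Complete multipartite graphs with parts of size at most 2 cover P_2, C_3, P_3
   and C_4.  Their RAAGs embed, by the maps [theta], into products of copies of
   F_2, and F_2 embeds into SL_2(Z) through unipotent matrices by ping-pong.
   Reducing modulo primes makes these RAAGs residually finite, hence Hopfian: a
   generating family satisfying the commutation relations is a vertex basis.
   The conditions of the proposition thus only have to force generation, which
   in (1) and (2) is Bezout's identity, and in (3) and (4) follows from the fact
   that centralizers of nontrivial elements of F_2 are abelian.  Conversely,
   centralizers of vertices are generated by stars, killing a vertex gives the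
   RAAG of the remaining graph, and the number of generators is read off from
   the abelianization. *)
From HB Require Import structures.
From mathcomp Require Import fingroup.
From mathcomp Require Import all_boot all_order all_algebra zify ring.
Require Import Defs.
From mathcomp Require Import boolp classical_sets.

Set Implicit Arguments.
Unset Strict Implicit.
Unset Printing Implicit Defensive.

Import Order.TTheory GRing.Theory Num.Theory.

Local Open Scope quotient_scope.
Local Open Scope classical_set_scope.
Local Open Scope group_scope.

(** * Subgroups and homomorphisms *)

Section Homomorphisms.
Variables (G H : groupType) (f : {multiplicative G -> H}).

Lemma hom1 : f 1 = 1.
Proof. by apply: (mulgI (f 1)); rewrite -gmulfM !mulg1. Qed.

Lemma homV x : f x^-1 = (f x)^-1.
Proof. by apply: (mulgI (f x)); rewrite -gmulfM !mulgV hom1. Qed.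

Lemma homF x y : f (x / y) = f x / f y.
Proof. by rewrite gmulfM homV. Qed.

Lemma homX x n : f (x ^+ n) = f x ^+ n.
Proof. by elim: n => [|n IH]; rewrite ?hom1 // !expgS gmulfM IH. Qed.

Lemma homZ x k : f (zpowg x k) = zpowg (f x) k.
Proof. by case: k => n; rewrite /= ?homV homX. Qed.

Lemma homR x y : f [~ x, y] = [~ f x, f y].
Proof. by rewrite commgEl conjgE !(gmulfM, homV). Qed.

Lemma hom_inj : (forall x, f x = 1 -> x = 1) -> injective f.
Proof. by move=> fI x y xy; apply/divg1_eq/fI; rewrite homF xy mulgV. Qed.

Lemma commute_hom x y : injective f -> commute (f x) (f y) -> commute x y.
Proof. by move=> fI; rewrite /commute -!gmulfM => /fI. Qed.

Lemma hom_is_multiple x : is_multiple x -> is_multiple (f x).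
Proof. by move=> [u [k [k2 ->]]]; exists (f u), k; rewrite homZ. Qed.

Lemma preim_subgroup (S : set H) : is_subgroup S -> is_subgroup (f @^-1` S).
Proof.
move=> /is_subgroupP[S1 SF]; apply/is_subgroupP; rewrite /preimage /=.
by rewrite hom1; split=> // x y Sx Sy; rewrite homF; exact: SF.
Qed.

Lemma image_subgroup (S : set G) : is_subgroup S -> is_subgroup (f @` S).
Proof.
move=> /is_subgroupP[S1 SF]; apply/is_subgroupP; split=> [|_ _ [x Sx <-] [y Sy <-]].
  by exists 1; rewrite // hom1.
by exists (x / y); [exact: SF|rewrite homF].
Qed.

End Homomorphisms.

Lemma hom_eq_gen (G H : groupType) (f g : {multiplicative G -> H}) (S : set G) :
  gen S = setT -> (forall x, S x -> f x = g x) -> f =1 g.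
Proof.
move=> ST fg x; have : gen S x by rewrite ST.
apply: (_ x); apply: smallest_sub; last exact: fg.
apply/is_subgroupP; split=> [|y z /= yE zE]; first by rewrite /= !hom1.
by rewrite !homF yE zE.
Qed.

Section Subgroups.
Variable G : groupType.
Implicit Types (S T : set G) (x y z : G).

Lemma is_subgroup1 S : is_subgroup S -> S 1.
Proof. by move=> /is_subgroupP[]. Qed.

Lemma is_subgroupV S x : is_subgroup S -> S x -> S x^-1.
Proof. by move=> /is_subgroupP[S1 SF] Sx; rewrite -div1g; exact: SF. Qed.

Lemma is_subgroupM S x y : is_subgroup S -> S x -> S y -> S (x * y).
Proof.
move=> gS Sx Sy; rewrite -[y]invgK; have /is_subgroupP[_] := gS; apply=> //.
exact: is_subgroupV.
Qed.

Lemma is_subgroupX S x n : is_subgroup S -> S x -> S (x ^+ n).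
Proof.
move=> gS Sx; elim: n => [|n IH]; first exact: is_subgroup1.
by rewrite expgS; exact: is_subgroupM.
Qed.

Lemma is_subgroupZ S x k : is_subgroup S -> S x -> S (zpowg x k).
Proof.
by move=> gS Sx; case: k => n; [|apply: is_subgroupV => //]; exact: is_subgroupX.
Qed.

Lemma gen_sub S T : is_subgroup T -> S `<=` T -> gen S `<=` T.
Proof. exact: smallest_sub. Qed.

Lemma gen_subset S T : S `<=` T -> gen S `<=` gen T.
Proof.
by move=> ST; apply: gen_sub (@gen_subgroup _ T) (subset_trans ST (@sub_gen _ T)).
Qed.

Lemma centralizer_subgroup x : is_subgroup (centralizer x).
Proof.
apply/is_subgroupP; split=> [|y z xy xz]; first exact: commute1.
exact/commuteM/commuteV.
Qed.

Lemma commuteZ x y k : commute x y -> commute x (zpowg y k).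
Proof. by move=> xy; apply: (is_subgroupZ k (centralizer_subgroup x)). Qed.

Lemma commuteZ2 x k l : commute (zpowg x k) (zpowg x l).
Proof. by apply/commuteZ/commute_sym/commuteZ/commute_refl. Qed.

Lemma zpowg1 k : zpowg (1 : G) k = 1.
Proof. by case: k => n; rewrite /= expg1n ?invg1. Qed.

Lemma zpowgS x k : zpowg x (k + 1)%R = zpowg x k * x.
Proof.
case: k => [n|[|n]].
- by rewrite -PoszD addn1 /= expgSr.
- by rewrite /= mulVg.
- by rewrite (_ : (Negz n.+1 + 1)%R = Negz n) /=; [rewrite [x ^+ n.+2]expgS invgM mulgVK|lia].
Qed.

Lemma zpowgD x k l : zpowg x (k + l)%R = zpowg x k * zpowg x l.
Proof.
have E n m : zpowg x (n + m%:Z)%R = zpowg x n * x ^+ m.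
  elim: m => [|m IH]; first by rewrite addr0 mulg1.
  by rewrite -addn1 PoszD addrA zpowgS IH addn1 expgSr mulgA.
case: l => l; first exact: E.
apply: (mulIg (x ^+ l.+1)); rewrite -E /= mulgVK; congr (zpowg x _); lia.
Qed.

Lemma zpowgN x k : zpowg x (- k)%R = (zpowg x k)^-1.
Proof. by apply: (mulgI (zpowg x k)); rewrite -zpowgD addrN mulgV. Qed.

Lemma zpowgM x k l : zpowg x (k * l)%R = zpowg (zpowg x k) l.
Proof.
have E n m : zpowg x (n * m%:Z)%R = zpowg x n ^+ m.
  elim: m => [|m IH]; first by rewrite mulr0.
  by rewrite -addn1 PoszD mulrDr mulr1 zpowgD IH addn1 expgSr.
by case: l => l; [exact: E|rewrite NegzE mulrN !zpowgN E].
Qed.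

Lemma zpowgMl x y k : commute x y -> zpowg (x * y) k = zpowg x k * zpowg y k.
Proof.
case: k => n xy /=; first exact: expgMn.
by rewrite expgMn // invgM; apply/commute_sym/commuteV/commute_sym/commuteV/commuteX2.
Qed.

Lemma cyclic_subgroup x : is_subgroup (range (zpowg x)).
Proof.
apply/is_subgroupP; split=> [|_ _ [k _ <-] [l _ <-]]; first by exists 0.
by exists (k - l)%R; rewrite // zpowgD zpowgN.
Qed.

Lemma gen1E x : gen [set x] = range (zpowg x).
Proof.
apply/seteqP; split.
  by apply: gen_sub (cyclic_subgroup x) _ => _ ->; exists 1%R.
by move=> _ [k _ <-]; apply: is_subgroupZ (@gen_subgroup _ _) _; exact: sub_gen.
Qed.

Lemma gen_commute S x : (forall y, S y -> commute x y) ->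
  forall y, gen S y -> commute x y.
Proof. by move=> xS y; apply: gen_sub (centralizer_subgroup x) xS _. Qed.

End Subgroups.

Lemma gen_image (G H : groupType) (f : {multiplicative G -> H}) (S : set G) :
  gen (f @` S) = f @` gen S.
Proof.
apply/seteqP; split.
  apply: gen_sub; first exact/image_subgroup/gen_subgroup.
  by move=> _ [x Sx <-]; exists x => //; exact: sub_gen.
move=> _ [x Sx <-]; apply: (gen_sub (preim_subgroup f (@gen_subgroup _ _))) Sx.
by move=> y Sy; apply: sub_gen; exists y.
Qed.

(** A synonym whose group law is addition, so that maps to the integers or to rational vector spaces
    become homomorphisms of type [{multiplicative _ -> _}]. *)
Definition mul_of (V : zmodType) : Type := V.

Section MulOf.
Variable V : zmodType.
HB.instance Definition _ := Choice.on (mul_of V).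

HB.instance Definition _ := isGroup.Build (mul_of V) (@addrA V) (@add0r V)
  (@addr0 V) (@addNr V) (@addrN V).

Lemma mul_ofM (x y : mul_of V) : x * y = (x + y)%R :> V.
Proof. by []. Qed.

Lemma mul_ofX (x : mul_of V) n : x ^+ n = ((x : V) *+ n)%R.
Proof. by elim: n => [|n IH] //; rewrite expgS IH [RHS]mulrS. Qed.

Lemma mul_ofZ (x : mul_of V) k : zpowg x k = ((x : V) *~ k)%R.
Proof. by case: k => n; rewrite /= mul_ofX. Qed.

Lemma mul_of_commute (x y : mul_of V) : commute x y.
Proof. exact: addrC. Qed.

End MulOf.

Lemma not_multiple_int (k : mul_of int) : `|k|%N = 1%N -> ~ is_multiple k.
Proof.
move=> k1 [u [l [l2]]]; rewrite mul_ofZ mulrzz => kE.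
move: k1; rewrite kE abszM => /eqP; rewrite muln_eq1 => /andP[_ /eqP l1].
by rewrite l1 in l2.
Qed.

(** The kernel of [e] contains [gen S], so a multiple in the quotient would make [e x], which is 1
    or -1, a multiple in the integers. *)
Lemma not_multiple_coset (G : groupType) (cG : forall x y : G, commute x y)
    (S : set G) (e : {multiplicative G -> mul_of int}) x :
  (forall y, S y -> e y = 1) -> `|e x|%N = 1%N ->
  ~ is_multiple (coset (abelian_gen cG S) x).
Proof.
move=> eS ex [U [k [k2]]]; have [u ->] := coset_surj U; rewrite -homZ.
move=> /cosetP Sxu; apply: (not_multiple_int ex); exists (e u), k; split=> //.
have : (e @^-1` [set 1]) (x^-1 * zpowg u k).
  apply: gen_sub Sxu; last exact: eS.
  apply: preim_subgroup; apply/is_subgroupP; split=> // _ _ -> ->.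
  by rewrite mulgV.
rewrite /preimage /= gmulfM homV homZ => /(congr1 (fun t => e x * t)).
by rewrite mulVKg mulg1.
Qed.

(** * Universal properties of free groups, quotients and RAAGs *)

Section Lifting.
Variables (X : choiceType) (H : groupType) (f : X -> H).

Definition eval_word (w : word X) : H :=
  \prod_(l <- w) (if l.2 then (f l.1)^-1 else f l.1).

Lemma eval_word_free_eq u v : free_eq u v -> eval_word u = eval_word v.
Proof.
rewrite /eval_word; elim=> // [{}u {}v x b|u' v' w _ -> _ ->] //.
rewrite !big_cat !big_cons; case: b => /=; first by rewrite mulKg.
by rewrite mulVKg.
Qed.

Definition free_lift (a : free X) : H := eval_word (repr a).

Lemma free_lift_word w : free_lift (of_word w) = eval_word w.
Proof.
by apply: eval_word_free_eq; apply/of_wordP; rewrite [LHS]reprK.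
Qed.

Lemma free_liftM : {morph free_lift : x y / x * y}.
Proof.
move=> a b; have [x ->] := of_word_surj a; have [y ->] := of_word_surj b.
by rewrite -of_wordM !free_lift_word /eval_word big_cat.
Qed.

HB.instance Definition _ := isMultiplicative.Build _ _ free_lift free_liftM.

Lemma free_lift_gen x : free_lift (free_gen x) = f x.
Proof. by rewrite free_lift_word /eval_word big_seq1. Qed.

End Lifting.

Lemma quot_liftP (G H : groupType) (N : normal_subgroup G)
    (f : {multiplicative G -> H}) :
  (forall x, nset N x -> f x = 1) ->
  exists g : {multiplicative quot N -> H}, forall x, g (coset N x) = f x.
Proof.
move=> fN; pose g (a : quot N) := f (repr a).
have gE x : g (coset N x) = f x.
  have /cosetP/fN : coset N (repr (coset N x)) = coset N x by rewrite [LHS]reprK.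
  by rewrite gmulfM homV => /mulg1_eq; rewrite invgK.
have gM : {morph g : x y / x * y}.
  move=> a b; have [x ->] := coset_surj a; have [y ->] := coset_surj b.
  by rewrite -cosetM !gE gmulfM.
pose gg := HB.pack_for {multiplicative quot N -> H} g (isMultiplicative.Build _ _ g gM).
by exists gg.
Qed.

Lemma ker_normal (G H : groupType) (f : {multiplicative G -> H}) :
  is_normal_subgroup [set x | f x = 1].
Proof.
split=> [|x y /= fx]; last by rewrite conjgE !gmulfM homV fx mul1g mulVg.
apply/is_subgroupP; split=> [|x y /=]; first exact: hom1.
by rewrite homF => -> ->; rewrite mulgV.
Qed.

Section Raag.
Variable Gamma : sgraph.

Lemma gen_raag : gen (range (@raag_gen Gamma)) = setT.
Proof.
rewrite -subTset => a _; have [x ->] := coset_surj a.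
have : gen (range (@free_gen Gamma)) x by rewrite gen_free.
move=> xG; rewrite (_ : range _ = coset _ @` range (@free_gen Gamma)).
  by rewrite gen_image; exists x.
by rewrite image_comp.
Qed.

Lemma raag_sub (S : set (raag Gamma)) :
  is_subgroup S -> (forall v, S (raag_gen v)) -> forall x, S x.
Proof.
move=> gS Sg x; suff: gen (range (@raag_gen Gamma)) x.
  by move: x; apply: gen_sub => // _ [v _ <-].
by rewrite gen_raag.
Qed.

Lemma raag_gen_commute (v w : Gamma) :
  adj v w -> commute (raag_gen v) (raag_gen w).
Proof.
move=> vw; apply/commgP/eqP; rewrite /raag_gen -homR -(hom1 (coset _)).
apply/cosetP; rewrite mulg1 => H [gH HS]; have [gH' _] := gH.
by apply: (is_subgroupV gH'); apply: HS; exists v, w.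
Qed.

(** The lift of [f] to the free group kills the relators, and its kernel is normal, so it contains
    their normal closure. *)
Lemma raag_liftP (H : groupType) (f : Gamma -> H) :
  (forall v w, adj v w -> commute (f v) (f w)) ->
  exists g : {multiplicative raag Gamma -> H}, forall v, g (raag_gen v) = f v.
Proof.
move=> fc; have [|g gE] := @quot_liftP _ _ (nclosure (raag_relators Gamma))
    (free_lift f : {multiplicative _ -> _}).
  apply: (@smallest_sub _ is_normal_subgroup) (ker_normal _) _.
  move=> _ [v [w [vw ->]]]; rewrite /= homR /= !free_lift_gen.
  exact/eqP/commgP/fc.
by exists g => v; rewrite gE /= free_lift_gen.
Qed.

Lemma raag_hom_eq (H : groupType) (f g : {multiplicative raag Gamma -> H}) :
  (forall v, f (raag_gen v) = g (raag_gen v)) -> f =1 g.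
Proof. by move=> fg; apply: (hom_eq_gen gen_raag) => _ [v _ <-]. Qed.

End Raag.

(** * Residual finiteness *)

Definition residually_finite (G : groupType) : Prop :=
  forall x : G, x <> 1 ->
    exists (K : finGroupType) (f : {multiplicative G -> K}), f x <> 1.

(* Malcev: the homomorphisms [f \o phi ^ n] into a finite group cannot be
   pairwise distinct, whereas [f x <> 1] and [phi x = 1] would separate them. *)
Lemma hopfian (G : groupType) (I : finType) (g : I -> G)
    (phi : {multiplicative G -> G}) :
  residually_finite G -> gen (range g) = setT ->
  (forall y, exists x, phi x = y) -> bijective phi.
Proof.
move=> rfG gT phiS; have iterM n : {morph iter n phi : x y / x * y}.
  by elim: n => [|n IH] x y //=; rewrite IH gmulfM.
have iter1 n : iter n phi 1 = 1 by elim: n => //= n ->; rewrite hom1.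
have iter_onto n y : exists x, iter n phi x = y.
  elim: n y => [|n IH] y; first by exists y.
  by have [x <-] := phiS y; have [z <-] := IH x; exists z.
suff phiI : injective phi.
  have [psi psiK] := choice phiS.
  by exists psi => // x; apply: phiI; rewrite psiK.
apply: hom_inj => x phix; apply: contrapT => /rfG[K [f fx]].
(* A homomorphism is determined by its values on the generators, and only finitely many families of
   values in [K] exist, so two iterates agree after [f]. *)
pose h n := [ffun i => f (iter n phi (g i))].
have [m [n [mn hmn]]] : exists m n, (m < n)%N /\ h m = h n.
  apply: contrapT => hD; pose N := #|{ffun I -> K}|.
  suff: injective (fun i : 'I_N.+1 => h i).
    by move=> /leq_card; rewrite card_ord ltnn.
  move=> i j hij; apply: val_inj; apply: contrapT => ij; apply: hD.
  by have [?|?|//] := ltngtP i j; [exists i, j|exists j, i].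
have fmn y : f (iter m phi y) = f (iter n phi y).
  suff: [set y | f (iter m phi y) = f (iter n phi y)] y by [].
  suff: gen (range g) y.
    move: y; apply: gen_sub.
      apply/is_subgroupP; rewrite /= !iter1; split=> // y z /= yE zE.
      have iterV k : iter k phi z^-1 = (iter k phi z)^-1.
        by apply: (mulgI (iter k phi z)); rewrite -iterM !mulgV iter1.
      by rewrite !iterM !iterV !homF yE zE.
    by move=> _ [i _ <-] /=; move/ffunP/(_ i): hmn; rewrite !ffunE.
  by rewrite gT.
(* With [iter m phi y = x] and [m < n], the element [iter n phi y] is an iterate of [phi x = 1],
   whereas [f x] is not 1. *)
have [y yx] := iter_onto m x; apply: fx; rewrite -yx fmn -(subnK mn).
by rewrite iterD iterS yx phix iter1 hom1.
Qed.

(* The matrix [[a, b], [c, d]] is encoded as [((a, b), (c, d))]. *)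
Definition sl2 (R : comNzRingType) : Type :=
  {q : (R * R) * (R * R) | (q.1.1 * q.2.2 - q.1.2 * q.2.1 == 1)%R}.

Section SL2.
Variable R : comNzRingType.
Implicit Types M N : sl2 R.

HB.instance Definition _ := SubChoice.on (sl2 R).

Lemma sl2_det M :
  ((val M).1.1 * (val M).2.2 - (val M).1.2 * (val M).2.1 = 1)%R.
Proof. exact/eqP/(valP M). Qed.

Definition Sl2 (a b c d : R) (dM : (a * d - b * c = 1)%R) : sl2 R :=
  exist _ ((a, b), (c, d)) (introT eqP dM).

Lemma sl2_eq M N :
  (val M).1.1 = (val N).1.1 -> (val M).1.2 = (val N).1.2 ->
  (val M).2.1 = (val N).2.1 -> (val M).2.2 = (val N).2.2 -> M = N.
Proof.
move=> a b c d; apply: val_inj; move: a b c d.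
by case: (val M) (val N) => [[? ?] [? ?]] [[? ?] [? ?]] /= -> -> -> ->.
Qed.

Lemma sl2_mul_subproof M N :
  (((val M).1.1 * (val N).1.1 + (val M).1.2 * (val N).2.1) *
   ((val M).2.1 * (val N).1.2 + (val M).2.2 * (val N).2.2) -
   ((val M).1.1 * (val N).1.2 + (val M).1.2 * (val N).2.2) *
   ((val M).2.1 * (val N).1.1 + (val M).2.2 * (val N).2.1) = 1)%R.
Proof.
transitivity (((val M).1.1 * (val M).2.2 - (val M).1.2 * (val M).2.1) *
  ((val N).1.1 * (val N).2.2 - (val N).1.2 * (val N).2.1))%R; first by ring.
by rewrite !sl2_det mulr1.
Qed.

Lemma sl2_inv_subproof M :
  ((val M).2.2 * (val M).1.1 - - (val M).1.2 * - (val M).2.1 = 1)%R.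
Proof. by rewrite mulrNN -[RHS](sl2_det M); ring. Qed.

Lemma sl2_one_subproof : (1 * 1 - 0 * 0 = 1 :> R)%R.
Proof. by rewrite !mulr0 mulr1 subr0. Qed.

Definition sl2_mul M N := Sl2 (sl2_mul_subproof M N).
Definition sl2_inv M := Sl2 (sl2_inv_subproof M).
Definition sl2_one := Sl2 sl2_one_subproof.

Let sl2_mulA : associative sl2_mul.
Proof. by move=> M N P; apply: sl2_eq => /=; ring. Qed.

Let sl2_mul1 : left_id sl2_one sl2_mul.
Proof. by move=> M; apply: sl2_eq => /=; ring. Qed.

Let sl2_1mul : right_id sl2_one sl2_mul.
Proof. by move=> M; apply: sl2_eq => /=; ring. Qed.

Let sl2_mulV : left_inverse sl2_one sl2_inv sl2_mul.
Proof. by move=> M; apply: sl2_eq => /=; do ?[by ring]; rewrite -[RHS](sl2_det M); ring. Qed.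

Let sl2_mulrV : right_inverse sl2_one sl2_inv sl2_mul.
Proof. by move=> M; apply: sl2_eq => /=; do ?[by ring]; rewrite -[RHS](sl2_det M); ring. Qed.

HB.instance Definition _ := isGroup.Build (sl2 R)
  sl2_mulA sl2_mul1 sl2_1mul sl2_mulV sl2_mulrV.

Lemma sl2_mulE M N : val (M * N) =
  (((val M).1.1 * (val N).1.1 + (val M).1.2 * (val N).2.1,
    (val M).1.1 * (val N).1.2 + (val M).1.2 * (val N).2.2),
   ((val M).2.1 * (val N).1.1 + (val M).2.2 * (val N).2.1,
    (val M).2.1 * (val N).1.2 + (val M).2.2 * (val N).2.2))%R.
Proof. by []. Qed.

End SL2.

HB.instance Definition _ (p : nat) := [Finite of sl2 'F_p by <:].

Section SL2Map.
Variables (R S : comNzRingType) (g : {rmorphism R -> S}).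

Lemma sl2_map_subproof (M : sl2 R) :
  (g (val M).1.1 * g (val M).2.2 - g (val M).1.2 * g (val M).2.1 = 1)%R.
Proof. by rewrite -!rmorphM -rmorphB sl2_det rmorph1. Qed.

Definition sl2_map (M : sl2 R) : sl2 S := Sl2 (sl2_map_subproof M).

Lemma sl2_mapM : {morph sl2_map : M N / M * N}.
Proof. by move=> M N; apply: sl2_eq; rewrite /= rmorphD !rmorphM. Qed.

HB.instance Definition _ := isMultiplicative.Build _ _ sl2_map sl2_mapM.

End SL2Map.

(** Some entry of the difference between [M] and the identity is a nonzero integer [z]; it stays
    nonzero modulo a prime greater than its absolute value. *)
Lemma sl2_int_residually_finite : residually_finite (sl2 int).
Proof.
move=> M M1; suff [z [z0 zP]] : exists z : int, (z != 0)%R /\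
    forall p, (z%:~R <> 0 :> 'F_p)%R ->
      sl2_map (intr : {rmorphism int -> 'F_p}) M <> 1.
  have [p p_gt pP] := prime_above `|z|.
  exists (sl2 'F_p), (sl2_map (intr : {rmorphism int -> 'F_p})).
  apply: zP => /eqP; rewrite -(dvdz_pcharf (pchar_Fp pP)) dvdzE.
  by move=> /dvdn_leq; rewrite absz_gt0 leqNgt p_gt => /(_ z0).
apply: contrapT => zN; apply: M1; apply: sl2_eq; apply: contrapT => Mz; apply: zN.
- exists ((val M).1.1 - 1)%R; split=> [|p]; first by apply/eqP => /subr0_eq.
  move=> + E; apply; rewrite rmorphB rmorph1; apply/eqP; rewrite subr_eq0.
  exact/eqP/(congr1 (fun N => (val N).1.1) E).
- exists (val M).1.2; split=> [|p]; first exact/eqP.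
  by move=> + E; apply; exact: (congr1 (fun N => (val N).1.2) E).
- exists (val M).2.1; split=> [|p]; first exact/eqP.
  by move=> + E; apply; exact: (congr1 (fun N => (val N).2.1) E).
- exists ((val M).2.2 - 1)%R; split=> [|p]; first by apply/eqP => /subr0_eq.
  move=> + E; apply; rewrite rmorphB rmorph1; apply/eqP; rewrite subr_eq0.
  exact/eqP/(congr1 (fun N => (val N).2.2) E).
Qed.

(** * The free group of rank 2 in SL_2(Z) *)

Lemma sl2_unip_subproof (b : bool) (t : int) :
  (1 * 1 - (if b then 0 else t) * (if b then t else 0) = 1)%R.
Proof. by case: b; ring. Qed.

(** Upper unitriangular for [false], lower for [true]; with [mul_of int] as source, the map is a
    homomorphism in the off-diagonal entry. *)
Definition sl2_unip b (t : mul_of int) : sl2 int := Sl2 (sl2_unip_subproof b t).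

Lemma sl2_unipM b : {morph sl2_unip b : s t / s * t}.
Proof. by case: b => s t; apply: sl2_eq; rewrite /= ?mul_ofM; ring. Qed.

HB.instance Definition _ b :=
  isMultiplicative.Build _ _ (sl2_unip b) (@sl2_unipM b).

(** The entry 3 serves twice: it moves [(1, 1)] strictly into the ping-pong sets, where 2 would not
    always do, and it makes every image congruent to the identity modulo 3, which excludes minus the
    identity. *)
Definition sanov : {multiplicative free bool -> sl2 int} :=
  free_lift (fun b => sl2_unip b 3%R).

Lemma sanov_gen b : sanov (free_gen b) = sl2_unip b 3%R.
Proof. exact: free_lift_gen. Qed.

Lemma sanov_genZ b k : sanov (zpowg (free_gen b) k) = sl2_unip b (3 * k)%R.
Proof. by rewrite homZ sanov_gen -homZ mul_ofZ mulrzz. Qed.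

Definition sl2_act (M : sl2 int) (v : int * int) : int * int :=
  ((val M).1.1 * v.1 + (val M).1.2 * v.2,
   (val M).2.1 * v.1 + (val M).2.2 * v.2)%R.

Lemma sl2_actM M N v : sl2_act (M * N) v = sl2_act M (sl2_act N v).
Proof. by rewrite /sl2_act sl2_mulE; congr (_, _) => /=; ring. Qed.

Definition inv_letter (X : Type) (l : X * bool) : X * bool := (l.1, ~~ l.2).

Section Reduced.
Variable X : choiceType.

Definition reduced (w : word X) : bool :=
  sorted (fun l m => m != inv_letter l) w.

Lemma free_eq_reduced (w : word X) : exists2 r, reduced r & free_eq w r.
Proof.
elim: w => [|l w [r rr wr]]; first by exists [::] => //; exact: FreeRefl.
have lwr : free_eq (l :: w) (l :: r).
  by apply: (@free_eq_cat _ [:: l] [:: l]) => //; exact: FreeRefl.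
case: r rr wr lwr => [|m r] rr wr lwr; first by exists [:: l].
have [ml|ml] := boolP (m == inv_letter l); last by exists (l :: m :: r) => //=; rewrite ml.
exists r; first by case: r rr {wr lwr} => //= k r /andP[].
apply: FreeTrans lwr _; rewrite (eqP ml); case: (l) => x b.
exact: (FreeCancel [::]).
Qed.

End Reduced.

(** [l.1] tells which coordinate the letter changes, and that coordinate dominates; the sign of the
    product records the sign of the exponent. *)
Definition pingpong (l : bool * bool) : set (int * int) :=
  [set v | if l.1 then (`|v.1| < `|v.2|)%R else (`|v.2| < `|v.1|)%R] `&`
  [set v | if l.2 then (v.1 * v.2 < 0)%R else (0 < v.1 * v.2)%R].

(** The letter adds 3 or -3 times one coordinate to the other. If the unchanged coordinate
    dominates, or the vector is [(1, 1)], the added term wins; otherwise [m] equals [l], the signs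
    agree, and the dominating coordinate grows. *)
Lemma pingpong_step l v :
  v = (1, 1)%R \/ (exists2 m, m != inv_letter l & pingpong m v) ->
  pingpong l (sl2_act (sanov (of_word [:: l])) v).
Proof.
have -> : sanov (of_word [:: l]) = sl2_unip l.1 (if l.2 then - 3 else 3)%R.
  case: l => b [] /=; last by rewrite sanov_gen.
  by rewrite of_wordV homV sanov_gen -homV.
case: v l => x y [[] []] [[-> ->]|[[[] []]]] //=;
  rewrite /pingpong /sl2_act /= ?mul1r ?mul0r ?addr0 ?add0r //.
all: by move=> _ []/=; split; nia.
Qed.

Lemma pingpong_reduced l w :
  reduced (l :: w) -> pingpong l (sl2_act (sanov (of_word (l :: w))) (1, 1)%R).
Proof.
elim: w l => [|m w IH] l; first by move=> _; apply: pingpong_step; left.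
move=> /andP[ml rw]; rewrite -cat1s of_wordM gmulfM sl2_actM.
by apply: pingpong_step; right; exists m => //; exact: IH.
Qed.

(** A nonempty reduced word sends [(1, 1)] to a vector whose coordinates differ in absolute value,
    so it does not act as the identity. *)
Lemma sanov_inj : injective sanov.
Proof.
apply: hom_inj => x; have [u ->] := of_word_surj x.
have [[|l w] rw ur] := free_eq_reduced u; first by move=> _; exact/of_wordP.
have /of_wordP -> := ur => E; have := pingpong_reduced rw; rewrite E.
by case: (l) => -[] [] [] /=; rewrite /sl2_act /= !mul1r !mul0r addr0 add0r ltxx.
Qed.

Lemma free_bool_residually_finite : residually_finite (free bool).
Proof.
move=> x x1; have [|K [f fx]] := @sl2_int_residually_finite (sanov x).
  by rewrite -(hom1 sanov) => /sanov_inj.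
by exists K, (f \o sanov : {multiplicative _ -> _}).
Qed.

(** Reduction modulo 3 after [sanov] is trivial, because it is so on the two generators. *)
Lemma sanov_mod3 x :
  [/\ ((val (sanov x)).1.1 = 1 %[mod 3])%Z, (3 %| (val (sanov x)).1.2)%Z,
      (3 %| (val (sanov x)).2.1)%Z & ((val (sanov x)).2.2 = 1 %[mod 3])%Z].
Proof.
pose m := sl2_map (intr : {rmorphism int -> 'F_3}).
have mx : m (sanov x) = 1.
  have mE : (m \o sanov : {multiplicative _ -> _}) =1
      ((@one_fun (free bool) (sl2 'F_3)) : {multiplicative _ -> _}).
    apply: (hom_eq_gen (@gen_free _)) => _ [b _ <-].
    rewrite /= sanov_gen; case: b; apply: sl2_eq => //=; exact/eqP.
  exact: mE.
have dvd3 z : (z%:~R = 0 :> 'F_3)%R -> (3 %| z)%Z.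
  by move=> /eqP; rewrite -(@dvdz_pcharf _ 3 (@pchar_Fp 3 isT)).
split.
- apply/eqP; rewrite eqz_mod_dvd; apply/dvd3; rewrite rmorphB rmorph1.
  apply/eqP; rewrite subr_eq0.
  exact/eqP/(congr1 (fun N => (val N).1.1) mx).
- exact/dvd3/(congr1 (fun N => (val N).1.2) mx).
- exact/dvd3/(congr1 (fun N => (val N).2.1) mx).
- apply/eqP; rewrite eqz_mod_dvd; apply/dvd3; rewrite rmorphB rmorph1.
  apply/eqP; rewrite subr_eq0; exact/eqP/(congr1 (fun N => (val N).2.2) mx).
Qed.

(** A scalar matrix of determinant 1 has diagonal entry 1 or -1, and -1 is not congruent to 1 modulo
    3. *)
Lemma sanov_scalar x : (val (sanov x)).1.2 = 0%R -> (val (sanov x)).2.1 = 0%R ->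
  (val (sanov x)).1.1 = (val (sanov x)).2.2 -> x = 1.
Proof.
move=> b0 c0 ad; apply: sanov_inj; rewrite hom1.
have [a3 _ _ _] := sanov_mod3 x; have := sl2_det (sanov x).
rewrite b0 mul0r subr0 -ad -expr2 => /eqP; rewrite sqrf_eq1.
move=> /orP[/eqP a1|/eqP a1]; last by rewrite a1 in a3.
by apply: sl2_eq; rewrite //= -?ad.
Qed.

(** Linear dependence, written as vanishing of 2 by 2 minors, passes through [u] because a nonzero
    coordinate of [u] can be cancelled. *)
Lemma proportional_trans (u v w : int * int * int) : u <> 0%R ->
  let par (x y : int * int * int) :=
    [/\ x.1.1 * y.1.2 = x.1.2 * y.1.1, x.1.1 * y.2 = x.2 * y.1.1 &
        x.1.2 * y.2 = x.2 * y.1.2]%R in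
  par u v -> par u w -> par v w.
Proof.
case: u v w => [[u1 u2] u3] [[v1 v2] v3] [[w1 w2] w3] u0 /= [v12 v13 v23].
(* Here [k] is the index of a nonzero coordinate of [u]; the minor of [v] and [w] vanishes after
   multiplication by the square of [uk]. *)
have par2 uk vk wk ui vi wi uj vj wj : uk <> 0%R ->
    (uk * vi = ui * vk -> uk * wi = ui * wk -> uk * vj = uj * vk ->
     uk * wj = uj * wk -> vi * wj = vj * wi :> int)%R.
  move=> /eqP uk0 vi' wi' vj' wj'; apply: (mulfI uk0); apply: (mulfI uk0).
  transitivity ((uk * vi) * (uk * wj))%R; first by ring.
  rewrite vi' wj'; transitivity ((uj * vk) * (ui * wk))%R; first by ring.
  by rewrite -vj' -wi'; ring.
move=> [w12 w13 w23]; have [u1E|/eqP u10] := eqVneq u1 0%R; last first.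
  by split; [ apply: (par2 u1 v1 w1 u1 v1 w1 u2 v2 w2)
    | apply: (par2 u1 v1 w1 u1 v1 w1 u3 v3 w3)
    | apply: (par2 u1 v1 w1 u2 v2 w2 u3 v3 w3)]; lia.
have [u2E|/eqP u20] := eqVneq u2 0%R; last first.
  by split; [ apply: (par2 u2 v2 w2 u1 v1 w1 u2 v2 w2)
    | apply: (par2 u2 v2 w2 u1 v1 w1 u3 v3 w3)
    | apply: (par2 u2 v2 w2 u2 v2 w2 u3 v3 w3)]; lia.
have u30 : u3 <> 0%R by move=> u3E; apply: u0; rewrite u1E u2E u3E.
by split; [ apply: (par2 u3 v3 w3 u1 v1 w1 u2 v2 w2)
    | apply: (par2 u3 v3 w3 u1 v1 w1 u3 v3 w3)
    | apply: (par2 u3 v3 w3 u2 v2 w2 u3 v3 w3)]; lia.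
Qed.

(* A nonscalar [2 x 2] matrix has an abelian centralizer: commutation means
   that the vectors [(b, c, a - d)] are proportional. *)
Lemma free_bool_commute_trans (w x y : free bool) :
  w <> 1 -> commute w x -> commute w y -> commute x y.
Proof.
move=> w1 wx wy.
pose par (x y : int * int * int) := [/\ (x.1.1 * y.1.2 = x.1.2 * y.1.1)%R,
  (x.1.1 * y.2 = x.2 * y.1.1)%R & (x.1.2 * y.2 = x.2 * y.1.2)%R].
pose vec (M : sl2 int) :=
  ((val M).1.2, (val M).2.1, (val M).1.1 - (val M).2.2)%R.
have commE (M N : sl2 int) : commute M N <-> par (vec M) (vec N).
  rewrite /par /vec /=; split=> [/(congr1 val)|[e1 e2 e3]].
    by rewrite !sl2_mulE => -[e11 e12 e21 e22]; split; lia.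
  by apply: sl2_eq; rewrite /= ?sl2_mulE /=; lia.
move: wx wy => /(gmulf_commute sanov)/commE wx /(gmulf_commute sanov)/commE wy.
apply/(commute_hom sanov_inj)/commE; apply: proportional_trans wx wy => -[b0 c0 /subr0_eq ad].
exact/w1/sanov_scalar.
Qed.

(** Commuting with the unipotent matrix forces equal diagonal entries and a zero opposite corner.
    The congruences modulo 3 then give diagonal 1 and a remaining entry divisible by 3. *)
Lemma free_bool_centralizer_gen b (x : free bool) :
  commute (free_gen b) x -> exists k, x = zpowg (free_gen b) k.
Proof.
move=> /(gmulf_commute sanov); rewrite sanov_gen => /(congr1 val).
suff: commute (sl2_unip b 3%R) (sanov x) ->
    exists k, sanov x = sl2_unip b (3 * k)%R.
  move=> + /val_inj cM => /(_ cM)[k xk].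
  by exists k; apply: sanov_inj; rewrite sanov_genZ.
have [a3 b3 c3 _] := sanov_mod3 x; have := sl2_det (sanov x).
move: (sanov x) a3 b3 c3 => M a3 b3 c3 dM /(congr1 val).
rewrite !sl2_mulE /= !(mul1r, mul0r, mulr1, mulr0, addr0, add0r) => cM.
have aE : ((val M).1.1 = (val M).2.2)%R by case: b cM => -[] /=; lia.
have bc0 : ((val M).1.2 * (val M).2.1 = 0)%R by case: b cM => -[] /=; nia.
have a1 : (val M).1.1 = 1%R.
  move: dM; rewrite bc0 subr0 -aE -expr2 => /eqP; rewrite sqrf_eq1.
  by move=> /orP[/eqP //|/eqP a1]; rewrite a1 in a3.
case: b cM => -[] /= e1 e2 e3 e4.
- move: c3 => /dvdzP[k kE]; exists k; clear dM bc0.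
  by apply: sl2_eq; rewrite /= -?aE ?a1 // ?kE 1?[RHS]mulrC //; lia.
- move: b3 => /dvdzP[k kE]; exists k; clear dM bc0.
  by apply: sl2_eq; rewrite /= -?aE ?a1 // ?kE 1?[RHS]mulrC //; lia.
Qed.

Lemma free_bool_not_commute :
  ~ commute (free_gen false : free bool) (free_gen true).
Proof.
move=> /(gmulf_commute sanov)/(congr1 val).
by rewrite !sanov_gen !sl2_mulE.
Qed.

(** * RAAGs of complete multipartite graphs *)

Definition raag_lift (Gamma : sgraph) (H : groupType) (f : Gamma -> H)
    (fc : forall v w, adj v w -> commute (f v) (f w)) :
  {multiplicative raag Gamma -> H} := sval (cid (raag_liftP fc)).

Lemma raag_lift_gen (Gamma : sgraph) (H : groupType) (f : Gamma -> H)
    (fc : forall v w, adj v w -> commute (f v) (f w)) v :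
  raag_lift fc (raag_gen v) = f v.
Proof. by rewrite /raag_lift; case: cid. Qed.

Section Exponent.
Variable Gamma : sgraph.

Definition exponent (v : Gamma) : {multiplicative raag Gamma -> mul_of int} :=
  raag_lift (fun w w' _ => mul_of_commute
    (if w == v then 1%R else 0%R : mul_of int) (if w' == v then 1%R else 0%R)).

Lemma exponent_gen v w : exponent v (raag_gen w) = if w == v then 1%R else 0%R.
Proof. exact: raag_lift_gen. Qed.

Lemma raag_gen_inj : injective (@raag_gen Gamma).
Proof.
move=> v w /(congr1 (exponent v)); rewrite !exponent_gen eqxx.
by case: eqP => [->|].
Qed.

End Exponent.

(* Complete multipartite graphs with parts of size at most 2: the vertices are
   labelled injectively by their part [part v] and a bit [bit v].  The group
   embeds by [theta] into a product of copies of the free group of rank 2. *)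
Section Multipartite.
Variables (Gamma : sgraph) (I : finType) (part : Gamma -> I) (bit : Gamma -> bool).
Hypothesis part_bit_inj : forall v w, part v = part w -> bit v = bit w -> v = w.
Hypothesis adjE : forall v w : Gamma, adj v w = (part v != part w).
Implicit Types (v w : Gamma) (i j : I) (x y z : raag Gamma).

Lemma theta_subproof i v w : adj v w ->
  commute (if part v == i then free_gen (bit v) else 1)
          (if part w == i then free_gen (bit w) else 1).
Proof.
rewrite adjE; have [->|_ _] := eqVneq (part v) i; last exact/commute_sym/commute1.
by rewrite eq_sym => /negPf ->; exact: commute1.
Qed.

Definition theta i : {multiplicative raag Gamma -> free bool} :=
  raag_lift (@theta_subproof i).

Lemma theta_gen i v :
  theta i (raag_gen v) = if part v == i then free_gen (bit v) else 1.
Proof. exact: raag_lift_gen. Qed.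

(** Together with [theta i] this yields the retraction onto the subgroup of part [i]. A bit that no
    vertex of the part carries is sent to 1. *)
Definition kappa i : {multiplicative free bool -> raag Gamma} :=
  free_lift (fun b => if [pick v | (part v == i) && (bit v == b)] is Some v
                      then raag_gen v else 1).

Lemma kappa_gen v : kappa (part v) (free_gen (bit v)) = raag_gen v.
Proof.
rewrite [LHS]free_lift_gen; case: pickP => [w /andP[/eqP pw /eqP bw]|/(_ v)].
  by rewrite (part_bit_inj pw bw).
by rewrite !eqxx.
Qed.

Definition proj i : {multiplicative raag Gamma -> raag Gamma} :=
  kappa i \o theta i.

Lemma projE i x : proj i x = kappa i (theta i x). Proof. by []. Qed.

Lemma proj_gen i v :
  proj i (raag_gen v) = if part v == i then raag_gen v else 1.
Proof. by rewrite projE theta_gen; case: eqP => [<-|_]; rewrite ?kappa_gen ?hom1. Qed.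

Lemma proj_mem i x : gen [set raag_gen v | v in [set v | part v = i]] (proj i x).
Proof.
move: x; apply: (raag_sub (preim_subgroup (proj i) (@gen_subgroup _ _))) => v.
change (gen [set raag_gen w | w in [set w | part w = i]] (proj i (raag_gen v))).
rewrite proj_gen; case: eqP => [vi|_]; last exact: (is_subgroup1 (@gen_subgroup _ _)).
by apply: sub_gen; exists v.
Qed.

(** Each projection lies in the subgroup generated by one part, and vertices of distinct parts are
    adjacent. *)
Lemma proj_commute i j x y : i != j -> commute (proj i x) (proj j y).
Proof.
move=> ij; apply: (gen_commute _ (proj_mem y)) => _ [w wj <-].
apply/commute_sym; apply: (gen_commute _ (proj_mem x)) => _ [v vi <-].
by apply/raag_gen_commute; rewrite adjE vi wj eq_sym.
Qed.

(** The product is a homomorphism because distinct projections commute, and on a generator all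
    factors but one are trivial. *)
Lemma prod_proj x : \prod_i proj i x = x.
Proof.
pose P y := \prod_(i <- index_enum I) proj i y.
have PM : {morph P : y z / y * z}.
  (* The induction runs over duplicate-free lists, so that [i] differs from all later indices and
     the projections commute. *)
  rewrite /P; move: (index_enum_uniq I); elim: (index_enum I) => [|i r IH].
    by move=> _ y z; rewrite !big_nil mulg1.
  rewrite cons_uniq => /andP[ir ru] y z; rewrite !big_cons IH // gmulfM.
  have yz : commute (proj i z) (\prod_(j <- r) proj j y).
    rewrite big_seq; apply: commute_prod => j jr; apply: proj_commute.
    by apply: contraNneq ir => ->.
  move: (proj i y) (proj i z) (\prod_(j <- r) proj j y) (\prod_(j <- r) proj j z) yz.
  by move=> a b c d bc; rewrite -!mulgA [b * (c * d)]mulgA bc !mulgA.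
pose PP := HB.pack_for {multiplicative raag Gamma -> raag Gamma} P
  (isMultiplicative.Build _ _ P PM).
suff: PP =1 idfun by apply.
apply: raag_hom_eq => v; rewrite /= /P.
under eq_bigr do rewrite proj_gen eq_sym.
rewrite -big_mkcond -big_filter filter_pred1_uniq ?index_enum_uniq //.
by rewrite big_seq1.
Qed.

Lemma proj_sub (S : set (raag Gamma)) x :
  is_subgroup S -> (forall i, S (proj i x)) -> S x.
Proof.
move=> gS Sx; rewrite -(prod_proj x).
by apply: big_ind => //; [exact: is_subgroup1|move=> *; exact: is_subgroupM].
Qed.

(** The maps [kappa i] recover the projections of an element from its images under [theta], and the
    projections multiply to the element. *)
Lemma theta_inj x y : (forall i, theta i x = theta i y) -> x = y.
Proof.
move=> xy; rewrite -(prod_proj x) -(prod_proj y).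
by apply: eq_bigr => i _; rewrite !projE xy.
Qed.

Lemma theta_commute x y :
  (forall i, commute (theta i x) (theta i y)) -> commute x y.
Proof. by move=> xy; apply: theta_inj => i; rewrite !gmulfM; exact: xy. Qed.

Lemma raag_residually_finite : residually_finite (raag Gamma).
Proof.
move=> x x1; have [i xi] : exists i, theta i x <> 1.
  apply: contrapT => xN; apply: x1; apply: theta_inj => i; rewrite hom1.
  by apply: contrapT => xi; apply: xN; exists i.
have [K [f fx]] := free_bool_residually_finite xi.
by exists K, (f \o theta i : {multiplicative _ -> _}).
Qed.

(** Generation makes the lift of [f] onto, and the Hopf property makes it bijective. For all four
    graphs, the passage from the conditions to a basis ends here. *)
Lemma raag_basis (f : Gamma -> raag Gamma) :
  (forall v w, adj v w -> commute (f v) (f w)) -> gen (range f) = setT ->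
  exists phi : {multiplicative raag Gamma -> raag Gamma},
    bijective phi /\ forall v, phi (raag_gen v) = f v.
Proof.
move=> fc fT; exists (raag_lift fc); split; last exact: raag_lift_gen.
apply: (hopfian raag_residually_finite (@gen_raag Gamma)) => y.
have : gen (raag_lift fc @` range (@raag_gen Gamma)) y.
  rewrite image_comp (_ : _ @` _ = range f) ?fT //.
  by apply: eq_imagel => v _; exact: raag_lift_gen.
by rewrite gen_image => -[x _ <-]; exists x.
Qed.

(** Where [theta i x] is nontrivial, commutation is transitive through it, so the centralizer of [x]
    has a commutative image there; a noncommuting pair is seen only where [x] is trivial. *)
Lemma centralizer_nonabelian x : ~ abelian_set (centralizer x) ->
  exists i, theta i x = 1 /\ exists y z,
    [/\ commute x y, commute x z & ~ commute (theta i y) (theta i z)].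
Proof.
move=> xN; apply: contrapT => thN; apply: xN => y z xy xz.
apply: theta_commute => i; apply: contrapT => yz; apply: thN; exists i.
split; last by exists y, z.
apply: contrapT => xi; apply: yz; apply: (free_bool_commute_trans xi).
  exact: gmulf_commute.
exact: gmulf_commute.
Qed.

Lemma commute_part i x v : theta i x = 1 -> part v = i -> commute x (raag_gen v).
Proof.
move=> xi vi; apply: theta_commute => j; rewrite theta_gen vi.
have [<-|_] := eqVneq i j; last exact: commute1.
by rewrite xi; exact/commute_sym/commute1.
Qed.

Lemma theta_cyclic v x : (forall w, part w = part v -> w = v) ->
  exists k, theta (part v) x = zpowg (free_gen (bit v)) k.
Proof.
move=> vP; have [] : range (zpowg (free_gen (bit v))) (theta (part v) x); last first.
  by move=> k _ <-; exists k.
apply: (raag_sub (preim_subgroup _ (cyclic_subgroup _))) => w.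
rewrite /preimage /= theta_gen; case: eqP => [/vP ->|_]; first by exists 1%R.
by exists 0%R.
Qed.

(** An element commuting with [v] projects to a power of [v] on the part of [v], and every other
    part consists of neighbours of [v]. *)
Lemma centralizer_gen v :
  centralizer (raag_gen v) = gen [set raag_gen w | w in [set w | w = v \/ adj v w]].
Proof.
apply/seteqP; split; last first.
  apply: gen_sub; first exact: centralizer_subgroup.
  move=> _ [w [->|vw] <-]; first exact: commute_refl.
  exact: raag_gen_commute.
move=> x vx; apply: proj_sub => [|i]; first exact: gen_subgroup.
have [<-|vi] := eqVneq (part v) i.
  have := gmulf_commute (theta (part v)) vx; rewrite theta_gen eqxx.
  move=> /free_bool_centralizer_gen[k xk]; rewrite projE xk homZ kappa_gen.
  by apply: is_subgroupZ (@gen_subgroup _ _) _; apply: sub_gen; exists v => //; left.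
apply: gen_subset (proj_mem x) => _ [w wi <-]; exists w => //; right.
by rewrite adjE wi.
Qed.

(** Distinct nonadjacent vertices share a part and differ in their bits, so [theta] sends them to
    the two free generators. *)
Lemma raag_gen_not_commute v w : v <> w -> ~~ adj v w ->
  ~ commute (raag_gen v) (raag_gen w).
Proof.
move=> vw; rewrite adjE negbK => /eqP pvw /(gmulf_commute (theta (part v))).
rewrite !theta_gen pvw eqxx => vwc; apply: free_bool_not_commute; move: vwc.
case bv: (bit v); case bw: (bit w) => //; try exact: commute_sym.
all: by move=> _; case: vw; apply: part_bit_inj; rewrite ?bv ?bw.
Qed.

End Multipartite.

(** * Numbers of generators and vertex quotients *)

Lemma gen_by_number_onto (G H : groupType) (f : {multiplicative G -> H}) n :
  (forall y, exists x, f x = y) -> gen_by_number G n -> gen_by_number H n.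
Proof.
move=> fS [s [<- sT]]; exists (map f s); split; first by rewrite size_map.
rewrite (_ : [set` map f s] = f @` [set` s]).
  rewrite gen_image sT -subTset => y _.
  by have [x <-] := fS y; exists x.
apply/seteqP; split=> [y /mapP[x xs ->]|_ [x xs <-]]; first by exists x.
exact: map_f.
Qed.

Lemma min_gensE (G : groupType) n : gen_by_number G n ->
  (forall m, gen_by_number G m -> (n <= m)%N) -> min_gens G = n.
Proof.
move=> Gn nP; rewrite /min_gens; case: pselect => [ex_n|]; last first.
  by case; exists n; exact/asboolP.
case: ex_minnP => m /asboolP Gm mP; apply/eqP; rewrite eqn_leq nP // andbT.
exact/mP/asboolP.
Qed.

Lemma raag_gen_by_number (Gamma : sgraph) : gen_by_number (raag Gamma) #|Gamma|.
Proof.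
exists (map (@raag_gen Gamma) (enum Gamma)); rewrite size_map -cardE; split=> //.
rewrite -(gen_raag Gamma); congr gen; apply/seteqP.
split=> [_ /mapP[v _ ->]|_ [v _ <-]]; first by exists v.
by apply: map_f; rewrite mem_enum.
Qed.

(** When the vertices are sent to the standard basis of a rational vector space, a generating
    sequence becomes a spanning family of rows, whose number bounds the dimension. *)
Lemma leq_raag_gen_by_number (Gamma : sgraph) n :
  gen_by_number (raag Gamma) n -> (#|Gamma| <= n)%N.
Proof.
move=> [s [<- sT]]; pose V := 'rV[rat]_#|Gamma|.
pose e : {multiplicative raag Gamma -> mul_of V} :=
  raag_lift (fun v w _ => mul_of_commute (delta_mx 0%R (enum_rank v) : mul_of V)
                                         (delta_mx 0%R (enum_rank w))).
pose M := (\matrix_(i < size s) (e (nth 1%g s i) : V))%R.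
have eM x : (e x <= M)%MS.
  suff: gen [set` s] x.
    move: x; apply: gen_sub.
      apply/is_subgroupP; split=> [|x y /= xM yM]; first by rewrite /= hom1 sub0mx.
      by rewrite homF addmx_sub // eqmx_opp.
    move=> x /= xs; rewrite -(nth_index 1 xs).
    have si : (index x s < size s)%N by rewrite index_mem.
    have <- : row (Ordinal si) M = (e (nth 1 s (index x s)) : V) by rewrite rowK.
    exact: row_sub.
  by rewrite sT.
have : row_full M.
  rewrite -sub1mx; apply/row_subP => i; rewrite row1.
  by have := eM (raag_gen (enum_val i)); rewrite /e raag_lift_gen enum_valK.
by move=> /eqP <-; exact: rank_leq_row.
Qed.

Lemma min_gens_isomorphic_raag (G : groupType) (Gamma : sgraph) :
  isomorphic G (raag Gamma) -> min_gens G = #|Gamma|.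
Proof.
move=> [f [g fK gK]].
pose g' := HB.pack_for {multiplicative raag Gamma -> G} g
  (isMultiplicative.Build _ _ g (can2_gmulfM fK gK)).
apply: min_gensE => [|n Gn].
  apply: (gen_by_number_onto (f := g')) (raag_gen_by_number Gamma) => x.
  by exists (f x); exact: fK.
apply/leq_raag_gen_by_number/(gen_by_number_onto (f := f)) => // y.
by exists (g y).
Qed.

Lemma min_gens_raag (Gamma : sgraph) : min_gens (raag Gamma) = #|Gamma|.
Proof. by apply: min_gens_isomorphic_raag; exists idfun, idfun. Qed.

Section DeleteVertex.
Variables (Gamma : sgraph) (v : Gamma).

Definition del_vertex_adj : rel {w : Gamma | w != v} :=
  fun w w' => adj (val w) (val w').

Lemma del_vertex_adj_sym : symmetric del_vertex_adj.
Proof. by move=> w w'; exact: adj_sym. Qed.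

Lemma del_vertex_adj_irrefl : irreflexive del_vertex_adj.
Proof. by move=> w; exact: adj_irrefl. Qed.

Definition del_vertex := SGraph del_vertex_adj_sym del_vertex_adj_irrefl.

Lemma card_del_vertex : #|Gamma| = (#|del_vertex| + 1)%N.
Proof.
rewrite addn1 card_sig (cardD1 v) /= add1n; congr _.+1.
by apply: eq_card => w; rewrite !inE andbT.
Qed.

(** Both inverse maps come from universal properties: [Q] undoes [phi] and then deletes [v], while
    [S] sends a remaining vertex to the class of its image under [phi]. *)
Lemma quot_vertex (phi : {multiplicative raag Gamma -> raag Gamma}) :
  bijective phi ->
  isomorphic (quot (nclosure [set phi (raag_gen v)])) (raag del_vertex).
Proof.
move=> [psi phiK psiK]; set N := nclosure _.
(* The deleted vertex [v] is the one that falls into the default branch 1. *)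
pose del w : raag del_vertex :=
  if insub w is Some w' then raag_gen (w' : del_vertex) else 1.
have delc w w' : adj w w' -> commute (del w) (del w').
  rewrite /del; case: insubP => [x _ xw|_ _]; last exact/commute_sym/commute1.
  case: insubP => [x' _ x'w|_ _]; last exact/commute1.
  by rewrite -xw -x'w; exact: (@raag_gen_commute del_vertex).
have delv : del v = 1 by rewrite /del insubF ?eqxx.
have delE (w : del_vertex) : del (val w) = raag_gen w by rewrite /del valK.
have [d dE] := raag_liftP delc.
pose psi' := HB.pack_for {multiplicative raag Gamma -> raag Gamma} psi
  (isMultiplicative.Build _ _ psi (can2_gmulfM phiK psiK)).
have [|Q QE] := @quot_liftP _ _ N (d \o psi' : {multiplicative _ -> _}).
  apply: (@smallest_sub _ is_normal_subgroup) (ker_normal _) _ => _ ->.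
  by rewrite /= phiK dE delv.
have [|S SE] := @raag_liftP del_vertex _ (fun w => coset N (phi (raag_gen (val w)))).
  move=> w w' ww'; apply: gmulf_commute; apply: gmulf_commute.
  exact: raag_gen_commute.
have Sd y : S (d y) = coset N (phi y).
  move: y; apply: (raag_hom_eq (f := S \o d : {multiplicative _ -> _})
    (g := coset N \o phi : {multiplicative _ -> _})) => w /=.
  have [->|wv] := eqVneq w v.
    rewrite dE delv hom1 -(hom1 (coset N)); apply/cosetP.
    by rewrite invg1 mul1g => H [_ HS]; exact: HS.
  by rewrite dE -[w]/(val (Sub w wv : del_vertex)) delE SE.
exists Q, S.
  by move=> a; have [x ->] := coset_surj a; rewrite QE /= Sd psiK.
move=> y; move: y; apply: (raag_hom_eq (f := Q \o S : {multiplicative _ -> _})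
  (g := idfun : {multiplicative _ -> _})) => w.
by rewrite /= SE QE /= phiK dE delE.
Qed.

End DeleteVertex.

(** * The four graphs *)

Lemma bij_inj_onto (T U : Type) (f : T -> U) :
  injective f -> (forall y, exists x, f x = y) -> bijective f.
Proof.
move=> fI fS; have [g gK] := choice fS.
by exists g => // x; apply: fI; rewrite gK.
Qed.

(** These are the exponent sums with respect to the new basis, obtained by undoing [phi]. *)
Lemma vertex_basis_exponent (Gamma : sgraph)
    (phi : {multiplicative raag Gamma -> raag Gamma}) : bijective phi ->
  exists e : Gamma -> {multiplicative raag Gamma -> mul_of int},
    forall v x, e v (phi x) = exponent v x.
Proof.
move=> [psi phiK psiK].
pose psi' := HB.pack_for {multiplicative raag Gamma -> raag Gamma} psi
  (isMultiplicative.Build _ _ psi (can2_gmulfM phiK psiK)).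
exists (fun v => exponent v \o psi' : {multiplicative _ -> _}) => v x.
by rewrite /= phiK.
Qed.

(** The exponent [t] is 1 or -1: absolute value at least 2 would exhibit [y] as a multiple, and
    [t = 0] would give [y = 1], the square of 1. Hence [t * t = 1]. *)
Lemma cyclic_primitive_generator (G : groupType) (z y : G) t :
  y = zpowg z t -> ~ is_multiple y -> exists s, z = zpowg y s.
Proof.
move=> -> zN; have t1 : `|t|%N = 1%N.
  case t2: `|t|%N => [|[|n]] //; case: zN; last by exists z, t; rewrite t2.
  by move/eqP: t2; rewrite absz_eq0 => /eqP ->; exists 1, (Posz 2); rewrite zpowg1.
exists t; rewrite -zpowgM (_ : t * t = 1)%R //.
by case: t t1 {zN} => [[|[]]|[]].
Qed.

(** * Primitive elements of commutative groups *)

Section CommutativeGroup.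
Variables (G : groupType) (cG : forall x y : G, commute x y).

Lemma zpowg_mul2 (p q : G) a b c d s t :
  zpowg (zpowg p a * zpowg q b) s * zpowg (zpowg p c * zpowg q d) t =
  zpowg p (a * s + c * t)%R * zpowg q (b * s + d * t)%R.
Proof.
rewrite !zpowgMl; try exact: cG.
rewrite !zpowgD !zpowgM -!mulgA; congr (_ * _).
by rewrite !mulgA; congr (_ * _); exact: cG.
Qed.

(** The coordinates of [x] are coprime, so Bezout's identity completes them to an integer matrix of
    determinant 1, whose second row gives [z]; the inverse matrix gives [s] and [t]. *)
Lemma primitive_complement (p q x : G) :
  (forall y, exists a b, y = zpowg p a * zpowg q b) -> ~ is_multiple x ->
  exists z, forall y, exists s t, y = zpowg x s * zpowg z t.
Proof.
move=> pqG xN; have [a [b xE]] := pqG x.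
have gcd1 : gcdz a b = 1%R.
  apply: contrapT => gN; apply: xN.
  have [g0|g0] := eqVneq (gcdz a b) 0%R.
    move/eqP: g0; rewrite gcdz_eq0 xE => /andP[/eqP -> /eqP ->].
    by exists 1, (Posz 2); rewrite zpowg1 mulg1.
  exists (zpowg p (a %/ gcdz a b)%Z * zpowg q (b %/ gcdz a b)%Z), (gcdz a b).
  split; last first.
    by rewrite zpowgMl ?xE -?zpowgM ?divzK ?dvdz_gcdl ?dvdz_gcdr.
  by move: g0 gN; rewrite /gcdz; case: (gcdn _ _) => [|[|]].
have [u [v uv]] := Bezoutz a b; rewrite gcd1 in uv.
exists (zpowg p (- v)%R * zpowg q u) => y; have [k [l ->]] := pqG y.
exists (u * k + v * l)%R, (a * l - b * k)%R; rewrite xE zpowg_mul2.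
congr (zpowg p _ * zpowg q _).
  by rewrite -[LHS]mul1r -uv; ring.
by rewrite -[LHS]mul1r -uv; ring.
Qed.

(** The quotient by [gen S] is cyclic, generated by the class of [z], so the primitive class of [y]
    generates it too. *)
Lemma gen_primitive (S : set G) (y z : G) :
  (forall w, exists t,
     coset (abelian_gen cG S) w = zpowg (coset (abelian_gen cG S) z) t) ->
  ~ is_multiple (coset (abelian_gen cG S) y) -> gen (S `|` [set y]) = setT.
Proof.
move=> zS yN; have [t yz] := zS y.
have [s zy] := cyclic_primitive_generator yz yN.
rewrite -subTset => w _; have [k] := zS w.
rewrite zy -!homZ => /esym/cosetP; set c := zpowg _ k => wS.
rewrite -[w](mulVKg c); apply: (is_subgroupM (@gen_subgroup _ _)).
  do 2 ![apply: (is_subgroupZ _ (@gen_subgroup _ _))].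
  by apply: sub_gen; right.
by apply: gen_subset wS; left.
Qed.

End CommutativeGroup.

(** Applied to the vertices behind a basis given as a set, this shows that they are pairwise
    distinct. *)
Lemma full_uniq (T : finType) (s : seq T) :
  (forall x, x \in s) -> (size s <= #|T|)%N -> uniq s.
Proof.
rewrite cardE => sT; apply: leq_size_uniq (enum_uniq T) _ => x _; exact: sT.
Qed.

Section CompleteGraph.
Variable Gamma : sgraph.
Hypothesis complete : forall v w : Gamma, adj v w = (v != w).

(** A complete graph is multipartite with single vertices as parts: [part] is the identity and every
    bit is [false]. *)
Let bit_inj (v w : Gamma) : v = w -> false = false -> v = w.
Proof. by []. Qed.

(** As each part is one vertex, [theta] at [v] takes values in the powers of one free generator, and
    the exponent is the exponent sum of [v]. *)
Lemma exponent_inj (x y : raag Gamma) :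
  (forall v, exponent v x = exponent v y) -> x = y.
Proof.
have thE v z : theta (part := id) (fun=> false) complete v z =
    zpowg (free_gen false) (exponent v z).
  move: z; apply: raag_sub => [|w].
    apply/is_subgroupP; split=> [|z z' /= zE zE']; first by rewrite /= !hom1.
    by rewrite !homF zE zE' [in RHS]/= zpowgD zpowgN.
  by rewrite /= theta_gen exponent_gen; case: eqP.
by move=> xy; apply: (theta_inj bit_inj (adjE := complete)) => v; rewrite !thE xy.
Qed.

Lemma complete_vertex_basis (f : Gamma -> raag Gamma) :
  (forall x y : raag Gamma, commute x y) -> gen (range f) = setT ->
  vertex_basis (range f).
Proof.
move=> cG fT; have [|phi [phiB phiE]] := raag_basis bit_inj complete _ fT.
  by move=> v w _; exact: cG.
exists phi; split=> //; rewrite image_comp.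
by apply: eq_imagel => v _; rewrite /= phiE.
Qed.

End CompleteGraph.

(** * The edge and the triangle *)

Lemma path2_complete (v w : path_graph 2) : adj v w = (v != w).
Proof. by case: v w => [[|[|//]] ?] [[|[|//]] ?]. Qed.

Lemma cycle3_complete (v w : cycle_graph 3) : adj v w = (v != w).
Proof. by case: v w => [[|[|[|//]]] ?] [[|[|[|//]]] ?]. Qed.

(** A basis has coordinate maps, and a coordinate equal to 1 prevents an element from being a
    multiple. Conversely, a complement of [x] generates the quotient by [x], hence so does the
    primitive class of [y]. *)
Lemma path2_basis (x y : raag (path_graph 2)) :
  vertex_basis [set x; y] <->
  ~ is_multiple x /\
  ~ is_multiple (coset (abelian_gen raag_P2_commute [set x]) y).
Proof.
split=> [[phi [phiB xyE]]|[xN yN]].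
  have [e eE] := vertex_basis_exponent phiB.
  have [_ [i _ <-] xi] : (phi @` range (@raag_gen _)) x by rewrite -xyE; left.
  have [_ [j _ <-] yj] : (phi @` range (@raag_gen _)) y by rewrite -xyE; right.
  have /andP[ij _] : uniq [:: i; j].
    apply: full_uniq => [k|]; last by rewrite card_ord.
    have : [set x; y] (phi (raag_gen k)).
      by rewrite xyE; exists (raag_gen k) => //; exists k.
    rewrite -xi -yj !inE => -[] /(bij_inj phiB)/raag_gen_inj ->;
      by rewrite eqxx ?orbT.
  rewrite inE in ij; split.
    move=> /(hom_is_multiple (e i)); apply: not_multiple_int.
    by rewrite -xi eE exponent_gen eqxx.
  apply: (not_multiple_coset (e := e j)) => [_ ->|].
    by rewrite -xi eE exponent_gen (negPf ij).
  by rewrite -yj eE exponent_gen eqxx.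
have pqG (z : raag (path_graph 2)) : exists a b,
    z = zpowg (raag_gen (ord0 : path_graph 2)) a *
        zpowg (raag_gen (ord_max : path_graph 2)) b.
  exists (exponent (ord0 : path_graph 2) z), (exponent (ord_max : path_graph 2) z).
  apply: (exponent_inj path2_complete) => v; rewrite gmulfM !homZ !mul_ofZ.
  rewrite !exponent_gen mul_ofM; case: v => [[|[|//]] v2] /=.
    by rewrite (_ : Ordinal v2 = ord0) ?mulrzz ?mul1r ?mul0r ?addr0 //; exact: val_inj.
  by rewrite (_ : Ordinal v2 = ord_max) ?mulrzz ?mul1r ?mul0r ?add0r //; exact: val_inj.
have [z zP] := primitive_complement raag_P2_commute pqG xN.
pose f (i : path_graph 2) := if i == ord0 then x else y.
have fE : range f = [set x] `|` [set y].
  apply/seteqP; split=> [_ [i _ <-]|_ [->|->]]; rewrite /f.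
  - by case: eqP; [left|right].
  - by exists ord0.
  - by exists ord_max.
rewrite -fE; apply: (complete_vertex_basis path2_complete raag_P2_commute).
rewrite fE; apply: (gen_primitive (z := z)) yN => w.
have [s [t ->]] := zP w; exists t; rewrite -homZ; apply/cosetP.
rewrite invgM -mulgA (raag_P2_commute _ (zpowg z t)) mulKg -zpowgN.
exact: is_subgroupZ (@gen_subgroup _ _) (sub_gen _).
Qed.

Lemma int_pairE (u v : int) :
  ((1, 0) *~ u + (0, 1) *~ v = (u, v) :> (int * int)%type)%R.
Proof.
by apply: injective_projections; rewrite ?(raddfD fst) ?(raddfD snd)
  !(raddfMz fst, raddfMz snd) /= !mulrzz !mul1r !mul0r ?addr0 ?add0r.
Qed.

(** The coordinates along [xi] and [eta] identify the quotient by [zeta] with pairs of integers.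
    Conversely, [xi] has a complement [z] in this quotient, and [eta] generates what is left modulo
    [zeta] and [xi]. *)
Lemma cycle3_basis (xi eta zeta : raag (cycle_graph 3)) :
  let modzeta := abelian_gen raag_C3_commute [set zeta] in
  let modzetaxi := abelian_gen raag_C3_commute [set zeta; xi] in
  vertex_basis [set xi; eta; zeta] <->
  [/\ isomorphic_add (quot modzeta) (int * int)%type,
      ~ is_multiple (coset modzeta xi) &
      ~ is_multiple (coset modzetaxi eta)].
Proof.
move=> modzeta modzetaxi; split=> [[phi [phiB basisE]]|[[f [fB fM]] xiN etaN]].
  have [e eE] := vertex_basis_exponent phiB.
  have [_ [i _ <-] xiE] : (phi @` range (@raag_gen _)) xi.
    by rewrite -basisE; left; left.
  have [_ [j _ <-] etaE] : (phi @` range (@raag_gen _)) eta.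
    by rewrite -basisE; left; right.
  have [_ [k _ <-] zetaE] : (phi @` range (@raag_gen _)) zeta.
    by rewrite -basisE; right.
  have allE l : l \in [:: i; j; k].
    have : [set xi; eta; zeta] (phi (raag_gen l)).
      by rewrite basisE; exists (raag_gen l) => //; exists l.
    by rewrite -xiE -etaE -zetaE !inE => -[[]|] /(bij_inj phiB)/raag_gen_inj ->;
      rewrite eqxx ?orbT.
  have : uniq [:: i; j; k] by apply: full_uniq => //; rewrite card_ord.
  rewrite /= !inE negb_or andbT => /andP[/andP[ij ik] jk].
  have eG l m : e l (phi (raag_gen m)) = if m == l then 1%R else 0%R.
    by rewrite eE exponent_gen.
  split; last 2 first.
  - apply: (not_multiple_coset (e := e i)) => [_ ->|].
      by rewrite -zetaE eG eq_sym (negPf ik).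
    by rewrite -xiE eG eqxx.
  - apply: (not_multiple_coset (e := e j)) => [_ [->|->]|].
    + by rewrite -zetaE eG eq_sym (negPf jk).
    + by rewrite -xiE eG (negPf ij).
    + by rewrite -etaE eG eqxx.
  pose F (x : raag (cycle_graph 3)) : mul_of (int * int)%type := (e i x, e j x).
  have FM : {morph F : x y / x * y}.
    by move=> x y; rewrite /F !gmulfM.
  pose F' := HB.pack_for {multiplicative raag (cycle_graph 3) -> mul_of (int * int)%type}
    F (isMultiplicative.Build _ _ F FM).
  have [|Q QE] := @quot_liftP _ _ modzeta F'.
    apply: (gen_sub (ker_normal F').1) => _ ->.
    by rewrite /= /F -zetaE !eG ![k == _]eq_sym (negPf ik) (negPf jk).
  suff QI : injective Q.
    exists Q; split; last by move=> x y; rewrite gmulfM.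
    apply: (bij_inj_onto QI) => -[a b].
    exists (coset _ (zpowg xi a * zpowg eta b)).
    rewrite QE /= /F !gmulfM !homZ -xiE -etaE !eG eqxx (negPf ij) eq_sym (negPf ij).
    by rewrite eqxx !mul_ofZ !mulrzz !mul_ofM /= !mul1r !mul0r addr0 add0r.
  apply: hom_inj => a; have [x ->] := coset_surj a.
  rewrite QE /= /F => -[xi0 xj0]; rewrite -(hom1 (coset _)); apply/cosetP.
  rewrite mulg1; apply: (is_subgroupV (@gen_subgroup _ _)).
  (* When the coordinates along [xi] and [eta] vanish, only a power of [zeta] remains. *)
  have -> : x = zpowg zeta (e k x).
    case: phiB xi0 xj0 => psi _ psiK; rewrite -[x]psiK !eE => xi0 xj0.
    rewrite -zetaE -homZ; congr (phi _); apply: (exponent_inj cycle3_complete) => l.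
    rewrite homZ mul_ofZ exponent_gen.
    have := allE l; rewrite !inE => /or3P[] /eqP ->.
    + by rewrite xi0 eq_sym (negPf ik) mul0rz.
    + by rewrite xj0 eq_sym (negPf jk) mul0rz.
    + by rewrite eqxx mulrzz mul1r.
  exact: is_subgroupZ (@gen_subgroup _ _) (sub_gen _).
pose f' := HB.pack_for {multiplicative quot modzeta -> mul_of (int * int)%type}
  f (isMultiplicative.Build (quot modzeta) (mul_of (int * int)%type) f fM).
have [g fK gK] := fB.
have quotC (a b : quot modzeta) : commute a b.
  have [x ->] := coset_surj a; have [y ->] := coset_surj b.
  exact/gmulf_commute/raag_C3_commute.
have pqG (a : quot modzeta) : exists k l,
    a = zpowg (g (1, 0)%R) k * zpowg (g (0, 1)%R) l.
  exists (f a).1, (f a).2; apply: (can_inj fK).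
  rewrite -[f]/(f' : _ -> _) gmulfM !homZ /= !gK !mul_ofZ mul_ofM.
  by rewrite [RHS]int_pairE -surjective_pairing.
have [a aP] := primitive_complement quotC pqG xiN.
have [z zE] := coset_surj a; rewrite {}zE {a} in aP.
pose h (i : cycle_graph 3) :=
  if i == ord0 then xi else if i == ord_max then eta else zeta.
have hE : range h = [set xi; eta; zeta].
  apply/seteqP; split=> [_ [i _ <-]|_ [[->|->]|->]]; rewrite /h.
  - by case: eqP; [left; left|case: eqP; [left; right|right]].
  - by exists ord0.
  - by exists ord_max.
  - by exists (inord 1) => //; rewrite -!val_eqE /= inordK.
rewrite -hE; apply: (complete_vertex_basis cycle3_complete raag_C3_commute).
rewrite hE setUAC [X in X `|` _]setUC.
apply: (gen_primitive (z := z)) etaN => w; have [s [t]] := aP (coset modzeta w).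
rewrite -!homZ -gmulfM => /cosetP wst; exists t; rewrite -homZ; apply/cosetP.
(* Modulo [zeta] and [xi] the factor [zpowg xi s] disappears, so the class of [w] is a power of that
   of [z]. *)
have -> : w^-1 * zpowg z t = w^-1 * (zpowg xi s * zpowg z t) * zpowg xi (- s)%R.
  by rewrite -!mulgA [zpowg z t * _]raag_C3_commute zpowgN mulVKg.
apply: (is_subgroupM (@gen_subgroup _ _)).
  by apply: gen_subset wst; left.
by apply: (is_subgroupZ _ (@gen_subgroup _ _)); apply: sub_gen; right.
Qed.

(** * The path on three vertices *)

Definition path3_part (v : path_graph 3) : bool := val v == 1%N.
Definition path3_bit (v : path_graph 3) : bool := val v == 2%N.

Lemma path3_part_bit_inj v w :
  path3_part v = path3_part w -> path3_bit v = path3_bit w -> v = w.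
Proof. by case: v w => [[|[|[|//]]] ?] [[|[|[|//]]] ?] // _ _; apply: val_inj. Qed.

Lemma path3_adjE (v w : path_graph 3) : adj v w = (path3_part v != path3_part w).
Proof. by case: v w => [[|[|[|//]]] ?] [[|[|[|//]]] ?]. Qed.

(** The inner vertex forms a part alone, so its component is cyclic; the endpoints give the free
    component. In both directions [chi] is central, so its centralizer is the whole group. *)
Lemma path3_basis (chi a b : raag (path_graph 3)) :
  (exists phi : {multiplicative raag (path_graph 3) -> raag (path_graph 3)},
     [/\ vertex_basis_by phi [set chi; a; b],
         chi = phi (raag_gen (inord 1 : path_graph 3)) &
         [set a; b] = [set phi (raag_gen (ord0 : path_graph 3));
                           phi (raag_gen (ord_max : path_graph 3))]]) <->
  [/\ ~ abelian_set (centralizer chi),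
      center (centralizer chi) = gen [set chi] &
      centralizer chi = gen [set chi; a; b]].
Proof.
pose inner : path_graph 3 := inord 1.
have inner1 : val inner = 1%N by rewrite /= inordK.
have innerP w : path3_part w = path3_part inner -> w = inner.
  by rewrite /path3_part inner1 eqxx => /eqP w1; apply: val_inj; rewrite w1.
pose th := theta path3_bit path3_adjE.
have partI : path3_part inner = true by rewrite /path3_part inner1.
have thT x : exists k, th true x = zpowg (free_gen (path3_bit inner)) k.
  by rewrite /th -partI; exact: theta_cyclic.
have thTC x y : commute (th true x) (th true y).
  by have [k ->] := thT x; have [l ->] := thT y; exact: commuteZ2.
split=> [[phi [[phiB basisE] chiE abE]]|[chiN _ chiG]].
  have [psi phiK psiK] := phiB.
  have innerC x : commute (raag_gen inner) x.
    apply: (theta_commute path3_part_bit_inj (adjE := path3_adjE)) => -[|].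
      exact: thTC.
    by rewrite theta_gen partI; exact/commute_sym/commute1.
  have chiC x : commute chi x.
    by rewrite chiE -[x]psiK; exact/gmulf_commute/innerC.
  have CT : centralizer chi = setT by rewrite -subTset => x _; exact: chiC.
  have not02 : ~ commute (raag_gen (ord0 : path_graph 3))
                         (raag_gen (ord_max : path_graph 3)).
    by apply: (raag_gen_not_commute path3_part_bit_inj path3_adjE).
  rewrite CT; split.
  - move=> /(_ (phi (raag_gen (ord0 : path_graph 3)))
      (phi (raag_gen (ord_max : path_graph 3))) I I).
    by move=> /(commute_hom (bij_inj phiB)).
  - apply/seteqP; split=> [z [_ zC]|]; last first.
      rewrite gen1E => _ [k _ <-]; split=> // y _.
      exact/commute_sym/commuteZ/commute_sym.
    have yC y : commute (psi z) y.
      by apply: (commute_hom (bij_inj phiB)); rewrite psiK; exact: zC.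
    rewrite gen1E -[z]psiK chiE; have [k kE] := thT (psi z).
    exists k => //; rewrite -homZ; congr (phi _).
    apply: (theta_inj path3_part_bit_inj (adjE := path3_adjE)) => -[|].
      by rewrite homZ theta_gen partI eqxx -kE.
    (* A central element with nontrivial free component would make the two endpoints commute, by
       transitivity of commutation. *)
    rewrite homZ theta_gen partI /= zpowg1; apply/esym; apply: contrapT => z1.
    apply: not02; apply: (theta_commute path3_part_bit_inj (adjE := path3_adjE)) => -[|].
      exact: thTC.
    by apply: (free_bool_commute_trans z1); exact/gmulf_commute/yC.
  - apply/esym; rewrite basisE gen_image gen_raag -subTset => x _.
    by exists (psi x).
(* The component of the inner vertex is commutative, so the noncommuting pair is seen in the other
   one, where [chi] is trivial. *)
have [[] [chi1 [y [z [chiy chiz yz]]]]] := centralizer_nonabelian path3_part_bit_inj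
    path3_adjE chiN.
  by case: yz; exact: thTC.
have chiC x : commute chi x.
  apply: (theta_commute path3_part_bit_inj (adjE := path3_adjE)) => -[|].
    exact: thTC.
  by rewrite chi1; exact/commute_sym/commute1.
have CT : gen [set chi; a; b] = setT.
  by rewrite -chiG -subTset => x _; exact: chiC.
pose f (v : path_graph 3) :=
  if v == ord0 then a else if v == ord_max then b else chi.
have finner : f inner = chi by rewrite /f -!val_eqE /= inner1.
have fE : range f = [set chi; a; b].
  apply/seteqP; split=> [_ [i _ <-]|_ [[->|->]|->]].
  - by rewrite /f; case: eqP; [left; right|case: eqP; [right|left; left]].
  - by exists inner.
  - by exists ord0.
  - by exists ord_max.
have [||phi [phiB phiE]] := raag_basis path3_part_bit_inj path3_adjE (f := f).
- move=> v w; rewrite path3_adjE; case vI: (path3_part v).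
    by rewrite (innerP v) ?vI ?partI // finner => _; exact: chiC.
  case wI: (path3_part w) => // _.
  by rewrite (innerP w) ?wI ?partI // finner; exact/commute_sym/chiC.
- by rewrite fE.
exists phi; rewrite !phiE -/inner finner; split=> //; split=> //.
rewrite -fE image_comp.
by apply: eq_imagel => v _; rewrite /= phiE.
Qed.

(** * The cycle on four vertices *)

Definition cycle4_part (v : cycle_graph 4) : bool := odd (val v).
Definition cycle4_bit (v : cycle_graph 4) : bool := (1 < val v)%N.

Lemma cycle4_part_bit_inj v w :
  cycle4_part v = cycle4_part w -> cycle4_bit v = cycle4_bit w -> v = w.
Proof.
by case: v w => [[|[|[|[|//]]]] ?] [[|[|[|[|//]]]] ?] // _ _; apply: val_inj.
Qed.

Lemma cycle4_adjE (v w : cycle_graph 4) :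
  adj v w = (cycle4_part v != cycle4_part w).
Proof. by case: v w => [[|[|[|[|//]]]] ?] [[|[|[|[|//]]]] ?]. Qed.

Lemma cycle4_adj_ordS (i : 'I_4) : adj (i : cycle_graph 4) (ordS i).
Proof. by case: i => [[|[|[|[|//]]]] ?]. Qed.

Lemma ord4_cases (i k : 'I_4) :
  [\/ k = ord_pred i, k = i, k = ordS i | k = ordS (ordS i)].
Proof.
have : [|| k == ord_pred i, k == i, k == ordS i | k == ordS (ordS i)].
  by case: i k => [[|[|[|[|//]]]] ?] [[|[|[|[|//]]]] ?].
by move=> /or4P[] /eqP ->; [constructor 1|constructor 2|constructor 3|constructor 4].
Qed.

Lemma cycle4_basis (u : 'I_4 -> raag (cycle_graph 4)) :
  (exists phi : {multiplicative raag (cycle_graph 4) -> raag (cycle_graph 4)},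
     vertex_basis_by phi (range u) /\
     forall i : 'I_4, exists v w : cycle_graph 4,
       [/\ adj v w, u i = phi (raag_gen v) & u (ordS i) = phi (raag_gen w)]) <->
  forall i : 'I_4,
    [/\ ~ abelian_set (centralizer (u i)),
        centralizer (u i) = gen [set u (ord_pred i); u i; u (ordS i)],
        is_raag (quot (nclosure [set u i])) &
        min_gens (raag (cycle_graph 4)) =
          (min_gens (quot (nclosure [set u i])) + 1)%N].
Proof.
split=> [[phi [[phiB rangeE] uadj]] i|uP].
  have phiI := bij_inj phiB; have [psi phiK psiK] := phiB.
  (* The map [s] lists the vertices underlying the basis; it is a bijective walk around the
     cycle. *)
  have /choice[s sE] : forall i, exists v : cycle_graph 4, u i = phi (raag_gen v).
    by move=> k; have [v [w [_ uk _]]] := uadj k; exists v.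
  have sadj k : adj (s k) (s (ordS k)).
    have [v [w [vw]]] := uadj k; rewrite !sE.
    by move=> /phiI/raag_gen_inj -> /phiI/raag_gen_inj ->.
  have s_onto v : exists k, s k = v.
    have : range u (phi (raag_gen v)).
      by rewrite rangeE; exists (raag_gen v) => //; exists v.
    by move=> [k _]; rewrite sE => /phiI/raag_gen_inj <-; exists k.
  have s_inj : injective s.
    (* A section of [s] is injective on a finite set, hence bijective, and so is [s]. *)
    have [t tK] := choice s_onto.
    have tB : bijective (t : 'I_4 -> 'I_4) := injF_bij (can_inj tK).
    by apply: (can_inj (g := t)); apply/(bij_can_sym tB).
  have spart k : cycle4_part (s (ordS k)) = ~~ cycle4_part (s k).
    by have := sadj k; rewrite cycle4_adjE; do 2 case: cycle4_part.
  have centE : centralizer (u i) = gen [set u (ord_pred i); u i; u (ordS i)].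
    transitivity (phi @` centralizer (raag_gen (s i))).
      rewrite sE; apply/seteqP; split=> [x sx|_ [x sx <-]]; last exact: gmulf_commute.
      by exists (psi x); rewrite ?psiK //; apply: (commute_hom phiI); rewrite psiK.
    rewrite (centralizer_gen cycle4_part_bit_inj cycle4_adjE) -gen_image.
    congr gen; apply/seteqP; split.
      move=> _ [_ [w sw <-] <-]; have [k kw] := s_onto w; rewrite -{}kw in sw *.
      rewrite -sE; have [->|->|->|k2] := ord4_cases i k.
      - by left; left.
      - by left; right.
      - by right.
      (* The opposite vertex lies in the same part as [s i], so it is not in the star. *)
      case: sw => [/s_inj ->|]; first by left; right.
      by rewrite cycle4_adjE k2 !spart negbK eqxx.
    move=> _ [[|]|] ->; rewrite sE.
    - exists (raag_gen (s (ord_pred i))) => //; exists (s (ord_pred i)) => //; right.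
      by rewrite adj_sym -{2}(ord_predK i).
    - by exists (raag_gen (s i)) => //; exists (s i) => //; left.
    - by exists (raag_gen (s (ordS i))) => //; exists (s (ordS i)) => //; right.
  have iso := quot_vertex (s i) phiB; rewrite -sE in iso.
  split=> //; last 2 first.
  - by exists (del_vertex (s i)).
  - by rewrite min_gens_raag (min_gens_isomorphic_raag iso) (card_del_vertex (s i)).
  (* The two neighbours of a vertex are opposite to each other, so they do not commute. *)
  rewrite centE => uC; have : commute (u (ord_pred i)) (u (ordS i)).
    by apply: uC; apply: sub_gen; [left; left|right].
  rewrite !sE => /(commute_hom phiI).
  apply: (raag_gen_not_commute cycle4_part_bit_inj cycle4_adjE).
    by move=> /s_inj; case: (i) => [[|[|[|[|//]]]] ?].
  by rewrite cycle4_adjE negbK -{2}(ord_predK i) !spart negbK.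
pose th := theta cycle4_bit cycle4_adjE.
have cent_sub i x : commute (u i) x -> gen (range u) x.
  have [_ CE _ _] := uP i; move=> ux; have : centralizer (u i) x by [].
  rewrite CE; apply: gen_subset => _ [[|]|] ->.
  - by exists (ord_pred i).
  - by exists i.
  - by exists (ordS i).
have nonab i : exists j, th j (u i) = 1 /\ exists y z,
    [/\ commute (u i) y, commute (u i) z & ~ commute (th j y) (th j z)].
  have [uN _ _ _] := uP i.
  exact: (centralizer_nonabelian cycle4_part_bit_inj cycle4_adjE uN).
have [j [uj [y [z [uy uz yz]]]]] := nonab ord0.
have [j' [uj' _]] := nonab (ordS ord0).
(* If [u ord0] and its successor were trivial in the same component, the centralizer of [u ord0]
   would have a cyclic image there, generated by the image of the other neighbour. *)
have jj' : j' = ~~ j.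
  suff : j' <> j by move: (j) (j') => [] [].
  move=> E; rewrite {}E in uj'; apply: yz.
  have cyc x : commute (u ord0) x -> range (zpowg (th j (u (ord_pred ord0)))) (th j x).
    move=> ux; suff : gen [set u (ord_pred ord0); u ord0; u (ordS ord0)] x.
      move: x {ux}; apply: gen_sub; first exact/preim_subgroup/cyclic_subgroup.
      move=> _ [[|]|] ->; rewrite /preimage /=; first by exists 1%R.
        by rewrite uj; exists 0%R.
      by rewrite uj'; exists 0%R.
    by have [_ <- _ _] := uP ord0.
  have [k _ <-] := cyc y uy; have [l _ <-] := cyc z uz; exact: commuteZ2.
(* Vertices of part [j] commute with [u ord0], the others with [u (ordS ord0)], and both
   centralizers are generated by values of [u]. *)
have uT : gen (range u) = setT.
  rewrite -subTset => x _; apply: raag_sub => [|v]; first exact: gen_subgroup.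
  have [vj|vj] := eqVneq (cycle4_part v) j.
    apply: (cent_sub ord0).
    exact: (commute_part cycle4_part_bit_inj (adjE := cycle4_adjE) uj).
  apply: (cent_sub (ordS ord0)).
  apply: (commute_part cycle4_part_bit_inj (adjE := cycle4_adjE) uj').
  by rewrite jj'; move: vj; case: (cycle4_part v) (j) => [] [].
have uS i : commute (u i) (u (ordS i)).
  have [_ CE _ _] := uP i; suff : centralizer (u i) (u (ordS i)) by [].
  by rewrite CE; apply: sub_gen; right.
have [||phi [phiB phiE]] := raag_basis cycle4_part_bit_inj cycle4_adjE
    (f := u : cycle_graph 4 -> _) => //.
  by move=> v w /andP[_ /orP[] /eqP ->]; [exact: uS|exact/commute_sym/uS].
exists phi; split; last first.
  move=> i; exists i, (ordS i); rewrite !phiE.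
  by split=> //; exact: cycle4_adj_ordS.
split=> //; rewrite image_comp.
by apply: eq_imagel => v _; rewrite /= phiE.
Qed.

Theorem proposition4p1 :
  (forall x y : raag (path_graph 2),
     vertex_basis [set x; y] <->
     ~ is_multiple x /\
     ~ is_multiple (coset (abelian_gen raag_P2_commute [set x]) y)) /\
  (forall xi eta zeta : raag (cycle_graph 3),
     let modzeta := abelian_gen raag_C3_commute [set zeta] in
     let modzetaxi := abelian_gen raag_C3_commute [set zeta; xi] in
     vertex_basis [set xi; eta; zeta] <->
     [/\ isomorphic_add (quot modzeta) (int * int)%type,
         ~ is_multiple (coset modzeta xi) &
         ~ is_multiple (coset modzetaxi eta)]) /\
  (forall chi a b : raag (path_graph 3),
     (exists phi : {multiplicative raag (path_graph 3) -> raag (path_graph 3)},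
        [/\ vertex_basis_by phi [set chi; a; b],
            chi = phi (raag_gen (inord 1 : path_graph 3)) &
            [set a; b] = [set phi (raag_gen (ord0 : path_graph 3));
                              phi (raag_gen (ord_max : path_graph 3))]]) <->
     [/\ ~ abelian_set (centralizer chi),
         center (centralizer chi) = gen [set chi] &
         centralizer chi = gen [set chi; a; b]]) /\
  (forall u : 'I_4 -> raag (cycle_graph 4),
     (exists phi : {multiplicative raag (cycle_graph 4) -> raag (cycle_graph 4)},
        vertex_basis_by phi (range u) /\
        forall i : 'I_4, exists v w : cycle_graph 4,
          [/\ adj v w, u i = phi (raag_gen v) &
              u (ordS i) = phi (raag_gen w)]) <->
     forall i : 'I_4,
       [/\ ~ abelian_set (centralizer (u i)),
           centralizer (u i) = gen [set u (ord_pred i); u i; u (ordS i)],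
           is_raag (quot (nclosure [set u i])) &
           min_gens (raag (cycle_graph 4)) =
             (min_gens (quot (nclosure [set u i])) + 1)%N]).
Proof.
split; first exact: path2_basis.
split; first exact: cycle3_basis.
by split; [exact: path3_basis|exact: cycle4_basis].
Qed.
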